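(* Let $M$ be a contact $CR$-lightlike submanifold of an indefinite Kenmotsu statistical manifold $(\bar M,\bar\nabla,\bar\nabla^{*},\bar g,\phi,\nu)$. Then $D\perp\{\nu\}$ defines a totally geodesic foliation in $M$ if and only if $$\bar g(h^{*l}(X,\phi Y),\xi)+\bar g(h^{l}(X,\phi Y),\xi)=0$$ and $$\bar g(h^{*s}(X,Y),\phi W)+\bar g(h^{s}(X,Y),\phi W)=0$$ for all $X,Y\in\Gamma(D\perp\{\nu\})$, $\xi\in\Gamma(Rad(TM))$ and $W\in\Gamma(\phi L_1)$.
   Context: Indefinite Kenmotsu statistical manifold $(\bar M,\bar\nabla,\bar\nabla^{*},\bar g,\phi,\nu)$: $\bar M$ is a $(2n+1)$-dimensional manifold with a semi-Riemannian metric $\bar g$ of constant index $q\ge1$, a torsion-free affine connection $\bar\nabla$ with $(\bar\nabla_X\bar g)(Y,Z)=(\bar\nabla_Y\bar g)(X,Z)$, dual connection $\bar\nabla^{*}$ defined by $X\bar g(Y,Z)=\bar g(\bar\nabla_XY,Z)+\bar g(Y,\bar\nabla^{*}_XZ)$, Levi-Civita connection $\widehat{\bar\nabla}=\frac12(\bar\nabla+\bar\nabla^{*})$, and $K(X,Y)=\bar\nabla_XY-\widehat{\bar\nabla}_XY$. It carries a $(1,1)$-tensor field $\phi$, a vector field $\nu$ and a $1$-form $\eta$ with $\bar g(\phi X,\phi Y)=\bar g(X,Y)-\eta(X)\eta(Y)$, $\bar g(\nu,\nu)=1$, $\phi^2X=-X+\eta(X)\nu$, $\bar g(X,\nu)=\eta(X)$,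 $\bar g(\phi X,Y)+\bar g(X,\phi Y)=0$, satisfying $(\widehat{\bar\nabla}_X\phi)Y=\eta(Y)\phi X-\bar g(\phi X,Y)\nu$, $\widehat{\bar\nabla}_X\nu=-X+\eta(X)\nu$, and $K(X,\phi Y)=-\phi K(X,Y)$, for all vector fields $X,Y,Z$ on $\bar M$. Lightlike submanifold: a submanifold $M$ of $\bar M$ with degenerate induced metric $g$ such that $Rad(TM)=TM\cap TM^{\perp}$ is a distribution of rank $r\ge1$. $S(TM)$ (screen distribution) is a chosen complement of $Rad(TM)$ in $TM$, $TM=Rad(TM)\perp S(TM)$; $S(TM^{\perp})$ (screen transversal bundle) is a chosen complement of $Rad(TM)$ in $TM^\perp$. The lightlike transversal bundle $ltr(TM)$ is locally spanned by sections $N_i$ of the orthogonal complement of $S(TM^\perp)$ in $S(TM)^\perp$ with $\bar g(\xi_i,N_j)=\delta_{ij}$, $\bar g(N_i,N_j)=0$ for a local basis $\{\xi_i\}$ of $Rad(TM)$. Put $tr(TM)=ltr(TM)\perp S(TM^\perp)$, so $T\bar M|_M=TM\oplus tr(TM)$. Gauss formulae: for $X,Y\in\Gamma(TM)$, $\bar\nabla_XY=\nabla_XY+h^l(X,Y)+h^s(X,Y)$ and $\bar\nabla^{*}_XY=\nabla^{*}_XY+h^{*l}(X,Y)+h^{*s}(X,Y)$, with $\nabla_XY,\nabla^*_XY\in\Gamma(TM)$, $h^l,h^{*l}$ valued in $ltr(TM)$, $h^s,h^{*s}$ valued in $S(TM^\perp)$. Also $\widehat\nabla_XY$ denotes the $TM$-component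 of $\widehat{\bar\nabla}_XY$. Contact $CR$-lightlike submanifold: a lightlike submanifold $M$ tangent to $\nu$ such that (1) $Rad(TM)\cap\phi(Rad(TM))=\{0\}$, with $\phi(Rad(TM))$ a distribution on $M$; (2) there are vector bundles $D_0$, $D'$ over $M$ with $S(TM)=\{\phi(Rad(TM))\oplus D'\}\perp D_0\perp\{\nu\}$, $\phi D_0=D_0$, $\phi(D')=L_1\perp ltr(TM)$, where $D_0$ is non-degenerate and $L_1$ is a vector subbundle of $S(TM^\perp)$. Put $D=Rad(TM)\perp\phi(Rad(TM))\perp D_0$, so $TM=D\oplus D'\perp\{\nu\}$. A distribution $E$ on $M$ defines a totally geodesic foliation if $\widehat\nabla_XY\in\Gamma(E)$ for all $X,Y\in\Gamma(E)$. *)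

(* Defs.v *)
From HB Require Import structures.
From mathcomp Require Import all_boot all_order all_algebra.
From mathcomp Require Import all_classical all_reals all_analysis.

Set Implicit Arguments.
Unset Strict Implicit.
Unset Printing Implicit Defensive.

Import Order.TTheory GRing.Theory Num.Theory.
Import numFieldNormedType.Exports.

Local Open Scope classical_set_scope.
Local Open Scope ring_scope.

(* In finite dimension, [f] is C^(k+1) on the open set [U] iff it is
   differentiable on [U] and each [x |-> 'd f x v] is C^k on [U]. *)
Fixpoint Ck_on (R : realType) (V W : normedModType R) (k : nat) (U : set V)
    (f : V -> W) : Prop :=
  match k with
  | 0%N => forall x, U x -> {for x, continuous f}
  | k'.+1 => (forall x, U x -> differentiable f x) /\
             (forall v : V, Ck_on k' U (fun x => 'd f x v))
  end.

Definition smooth_on (R : realType) (V W : normedModType R) (U : set V)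
    (f : V -> W) : Prop := forall k, Ck_on k U f.

(* A smooth manifold without boundary of dimension [d].  The map [chart_inv i]
   is only relevant on the open set [chart i @` chart_dom i]. *)
Record manifold (R : realType) (d : nat) := Manifold {
  carrier :> topologicalType ;
  chart_idx : Type ;
  chart_dom : chart_idx -> set carrier ;
  chart : chart_idx -> carrier -> 'rV[R]_d ;
  chart_inv : chart_idx -> 'rV[R]_d -> carrier ;
  chart_at : carrier -> chart_idx ;
  manifold_hausdorff : hausdorff_space carrier ;
  manifold_second_countable : @second_countable carrier ;
  mem_chart_at : forall p, chart_dom (chart_at p) p ;
  open_chart_dom : forall i, open (chart_dom i) ;
  open_chart_img : forall i, open (chart i @` chart_dom i) ;
  chartK : forall i p, chart_dom i p -> chart_inv i (chart i p) = p ;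
  chart_continuous : forall i p, chart_dom i p ->
    {for p, continuous (chart i)} ;
  chart_inv_continuous : forall i x, (chart i @` chart_dom i) x ->
    {for x, continuous (chart_inv i)} ;
  chart_transition : forall i j,
    smooth_on (chart i @` (chart_dom i `&` chart_dom j))
      (chart j \o chart_inv i)
}.

Arguments chart_dom {R d} m _ _.
Arguments chart {R d} m _ _.
Arguments chart_inv {R d} m _ _.
Arguments chart_at {R d} m _.

(* The tangent space of [M] at [p] is 'rV[R]_d, a vector being represented by
   its components in the preferred chart [chart_at M p].  Consequently the
   components of a vector field are not meaningful as a function of [p] until
   they are transported to a fixed chart by [tcoord]. *)
Section Manifolds.
Variables (R : realType) (d : nat) (M : manifold R d).

(* components in the chart [i] of the tangent vector [v] at [p] *)
Definition tcoord (i : chart_idx M) (p : M) (v : 'rV[R]_d) : 'rV[R]_d :=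
  'd (chart M i \o chart_inv M (chart_at M p)) (chart M (chart_at M p) p) v.

Definition smooth_fun (f : M -> R) : Prop :=
  forall i, smooth_on (chart M i @` chart_dom M i) (f \o chart_inv M i).

(* v(f), for a tangent vector [v] at [p] *)
Definition dirder (p : M) (v : 'rV[R]_d) (f : M -> R) : R :=
  'd (f \o chart_inv M (chart_at M p)) (chart M (chart_at M p) p) v.

Definition smooth_vfield (X : M -> 'rV[R]_d) : Prop :=
  forall i, smooth_on (chart M i @` chart_dom M i)
    (fun x => tcoord i (chart_inv M i x) (X (chart_inv M i x))).

(* the function X f *)
Definition vfield_act (X : M -> 'rV[R]_d) (f : M -> R) : M -> R :=
  fun p => dirder p (X p) f.

Definition negative_definite_on (f : {symmetric 'rV[R]_d})
    (W : {vspace 'rV[R]_d}) : Prop :=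
  forall w, w \in W -> w != 0 -> f w w < 0.

Definition has_index (f : {symmetric 'rV[R]_d}) (q : nat) : Prop :=
  (exists2 W : {vspace 'rV[R]_d}, \dim W = q & negative_definite_on f W) /\
  (forall W : {vspace 'rV[R]_d}, negative_definite_on f W -> (\dim W <= q)%N).

Definition semi_riemannian_metric (q : nat) (g : M -> {symmetric 'rV[R]_d}) :
    Prop :=
  [/\ forall X Y, smooth_vfield X -> smooth_vfield Y ->
        smooth_fun (fun p => g p (X p) (Y p)),
      forall p, nondegenerate (g p)
    & forall p, has_index (g p) q].

Definition vfield_op := (M -> 'rV[R]_d) -> (M -> 'rV[R]_d) -> (M -> 'rV[R]_d).

(* Only the values at smooth vector fields are constrained. *)
Record affine_connection (nab : vfield_op) : Prop := AffineConnection {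
  conn_smooth : forall X Y, smooth_vfield X -> smooth_vfield Y ->
    smooth_vfield (nab X Y) ;
  connDl : forall X X' Y, smooth_vfield X -> smooth_vfield X' ->
    smooth_vfield Y ->
    forall p, nab (fun q => X q + X' q) Y p = nab X Y p + nab X' Y p ;
  connZl : forall f X Y, smooth_fun f -> smooth_vfield X -> smooth_vfield Y ->
    forall p, nab (fun q => f q *: X q) Y p = f p *: nab X Y p ;
  connDr : forall X Y Y', smooth_vfield X -> smooth_vfield Y ->
    smooth_vfield Y' ->
    forall p, nab X (fun q => Y q + Y' q) p = nab X Y p + nab X Y' p ;
  conn_leibniz : forall f X Y, smooth_fun f -> smooth_vfield X ->
    smooth_vfield Y ->
    forall p, nab X (fun q => f q *: Y q) p =
      vfield_act X f p *: Y p + f p *: nab X Y p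
}.

(* nab_X Y - nab_Y X = [X, Y], both sides being compared as derivations *)
Definition torsion_free (nab : vfield_op) : Prop :=
  forall X Y f, smooth_vfield X -> smooth_vfield Y -> smooth_fun f ->
  forall p, dirder p (nab X Y p - nab Y X p) f =
    vfield_act X (vfield_act Y f) p - vfield_act Y (vfield_act X f) p.

(* (nab_X g)(Y, Z) *)
Definition cov_metric (g : M -> {symmetric 'rV[R]_d}) (nab : vfield_op)
    (X Y Z : M -> 'rV[R]_d) : M -> R :=
  fun p => vfield_act X (fun q => g q (Y q) (Z q)) p
           - g p (nab X Y p) (Z p) - g p (Y p) (nab X Z p).

Definition dual_connections (g : M -> {symmetric 'rV[R]_d})
    (nab nabs : vfield_op) : Prop :=
  forall X Y Z, smooth_vfield X -> smooth_vfield Y -> smooth_vfield Z ->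
  forall p, vfield_act X (fun q => g q (Y q) (Z q)) p =
    g p (nab X Y p) (Z p) + g p (Y p) (nabs X Z p).

Definition mean_op (nab nabs : vfield_op) : vfield_op :=
  fun X Y p => 2^-1 *: (nab X Y p + nabs X Y p).

End Manifolds.

Record kenmotsu_statistical (R : realType) (n : nat)
    (M : manifold R n.*2.+1) (q : nat) := KenmotsuStatistical {
  metric : M -> {symmetric 'rV[R]_(n.*2.+1)} ;
  conn : vfield_op M ;
  dconn : vfield_op M ;
  phi : M -> 'End('rV[R]_(n.*2.+1)) ;
  nu : M -> 'rV[R]_(n.*2.+1) ;
  eta : M -> {scalar 'rV[R]_(n.*2.+1)} ;
  lc_conn := mean_op conn dconn ;
  index_ge1 : (1 <= q)%N ;
  metricP : semi_riemannian_metric q metric ;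
  conn_affine : affine_connection conn ;
  dconn_affine : affine_connection dconn ;
  conn_torsion_free : torsion_free conn ;
  conn_codazzi : forall X Y Z, smooth_vfield X -> smooth_vfield Y ->
    smooth_vfield Z ->
    forall p, cov_metric metric conn X Y Z p = cov_metric metric conn Y X Z p ;
  conn_dual : dual_connections metric conn dconn ;
  phi_smooth : forall X, smooth_vfield X ->
    smooth_vfield (fun p => phi p (X p)) ;
  nu_smooth : smooth_vfield nu ;
  eta_smooth : forall X, smooth_vfield X -> smooth_fun (fun p => eta p (X p)) ;
  metric_phi : forall p u v,
    metric p (phi p u) (phi p v) = metric p u v - eta p u * eta p v ;
  metric_nu_nu : forall p, metric p (nu p) (nu p) = 1 ;
  phi_phi : forall p u, phi p (phi p u) = - u + eta p u *: nu p ;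
  metric_nu : forall p u, metric p u (nu p) = eta p u ;
  phi_skew : forall p u v, metric p (phi p u) v + metric p u (phi p v) = 0 ;
  kenmotsu_phi : forall X Y, smooth_vfield X -> smooth_vfield Y ->
    forall p,
      lc_conn X (fun r => phi r (Y r)) p - phi p (lc_conn X Y p) =
      eta p (Y p) *: phi p (X p) - metric p (phi p (X p)) (Y p) *: nu p ;
  kenmotsu_nu : forall X, smooth_vfield X ->
    forall p, lc_conn X nu p = - X p + eta p (X p) *: nu p ;
  kenmotsu_K : forall X Y, smooth_vfield X -> smooth_vfield Y ->
    let K (A B : M -> 'rV[R]_(n.*2.+1)) p := conn A B p - lc_conn A B p in
    forall p, K X (fun r => phi r (Y r)) p = - phi p (K X Y p)
}.

(* Bundles over [M] are viewed inside the pullback of the tangent bundle of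
   [N] by [imm]: a family of subspaces of the spaces T_(imm p) N.  A vector
   field along [imm] is a map [V] with [V p] in T_(imm p) N; a vector field
   on [M] is identified with its push-forward, a vector field along [imm] with
   values in [tangent_bundle]. *)
Section Along.
Variables (R : realType) (m d : nat) (M : manifold R m) (N : manifold R d).
Variable imm : M -> N.

Definition smooth_map : Prop :=
  continuous imm /\
  forall i j,
    smooth_on (chart M i @` (chart_dom M i `&` imm @^-1` chart_dom N j))
      (chart N j \o imm \o chart_inv M i).

Definition pushforward (p : M) (v : 'rV[R]_m) : 'rV[R]_d :=
  'd (chart N (chart_at N (imm p)) \o imm \o chart_inv M (chart_at M p))
     (chart M (chart_at M p) p) v.

Definition submanifold : Prop :=
  [/\ smooth_map, injective imm & forall p, injective (pushforward p)].

Definition smooth_along (U : set M) (V : M -> 'rV[R]_d) : Prop :=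
  forall i j,
    smooth_on (chart M i @` (U `&` chart_dom M i `&` imm @^-1` chart_dom N j))
      (fun x => tcoord j (imm (chart_inv M i x)) (V (chart_inv M i x))).

Definition bundle := M -> {vspace 'rV[R]_d}.

Definition subbundle (E : bundle) : Prop :=
  forall p, exists U : set M, [/\ open U, U p &
    exists (k : nat) (e : 'I_k -> M -> 'rV[R]_d),
      (forall i, smooth_along U (e i)) /\
      (forall x, U x -> basis_of (E x) [tuple e i x | i < k])].

Definition has_rank (k : nat) (E : bundle) : Prop := forall p, \dim (E p) = k.

Definition is_section (E : bundle) (V : M -> 'rV[R]_d) : Prop :=
  smooth_along setT V /\ forall p, V p \in E p.

Definition full_bundle : bundle := fun=> fullv.

Definition tangent_bundle : bundle := fun p => limg (linfun (pushforward p)).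

Definition along_op := (M -> 'rV[R]_d) -> (M -> 'rV[R]_d) -> (M -> 'rV[R]_d).

(* [D X Y] is nab_X Y for [X] in Gamma(TM) and [Y] a vector field along
   [imm]: the connection induced by [nab] on the pullback bundle.  It exists
   and is unique, on such [X] and [Y], for every affine connection [nab]. *)
Record induced_connection (nab : vfield_op N) (D : along_op) : Prop :=
    InducedConnection {
  ind_smooth : forall X Y, is_section tangent_bundle X ->
    is_section full_bundle Y -> is_section full_bundle (D X Y) ;
  indDl : forall X X' Y, is_section tangent_bundle X ->
    is_section tangent_bundle X' -> is_section full_bundle Y ->
    forall p, D (fun q => X q + X' q) Y p = D X Y p + D X' Y p ;
  indZl : forall f X Y, smooth_fun f -> is_section tangent_bundle X ->
    is_section full_bundle Y ->
    forall p, D (fun q => f q *: X q) Y p = f p *: D X Y p ;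
  indDr : forall X Y Y', is_section tangent_bundle X ->
    is_section full_bundle Y -> is_section full_bundle Y' ->
    forall p, D X (fun q => Y q + Y' q) p = D X Y p + D X Y' p ;
  ind_leibniz : forall f X Y, smooth_fun f -> is_section tangent_bundle X ->
    is_section full_bundle Y ->
    forall p v, pushforward p v = X p ->
    D X (fun q => f q *: Y q) p = dirder p v f *: Y p + f p *: D X Y p ;
  ind_restrict : forall X Xbar Ybar, is_section tangent_bundle X ->
    smooth_vfield Xbar -> smooth_vfield Ybar ->
    forall p, Xbar (imm p) = X p ->
    D X (fun q => Ybar (imm q)) p = nab Xbar Ybar (imm p)
}.

Definition mean_along (D Ds : along_op) : along_op :=
  fun X Y p => 2^-1 *: (D X Y p + Ds X Y p).

End Along.

Arguments bundle {R m} d M.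
Arguments along_op {R m} d M.

Record lightlike_submanifold (R : realType) (m d : nat) (M : manifold R m)
    (N : manifold R d) (g : N -> {symmetric 'rV[R]_d}) := LightlikeSubmanifold {
  imm : M -> N ;
  rad_rank : nat ;
  screen : bundle d M ;
  screen_transversal : bundle d M ;
  ltr : bundle d M ;
  TM : bundle d M := tangent_bundle imm ;
  TMperp : bundle d M := fun p => orthov (g (imm p)) (TM p) ;
  Rad : bundle d M := fun p => (TM p :&: TMperp p)%VS ;
  immP : submanifold imm ;
  rad_rank_ge1 : (1 <= rad_rank)%N ;
  Rad_rank : has_rank rad_rank Rad ;
  Rad_subbundle : subbundle imm Rad ;
  screen_subbundle : subbundle imm screen ;
  screenP : forall p,
    TM p = (Rad p + screen p)%VS /\ directv (Rad p + screen p) ;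
  screen_transversal_subbundle : subbundle imm screen_transversal ;
  screen_transversalP : forall p,
    TMperp p = (Rad p + screen_transversal p)%VS /\
    directv (Rad p + screen_transversal p) ;
  ltrP : forall p, exists U : set M, [/\ open U, U p &
    exists xi N_ : 'I_rad_rank -> M -> 'rV[R]_d,
      (forall i, smooth_along imm U (xi i) /\ smooth_along imm U (N_ i)) /\
      (forall x, U x ->
        [/\ basis_of (Rad x) [tuple xi i x | i < rad_rank],
            ltr x = <<[tuple N_ i x | i < rad_rank]>>%VS,
            forall i, N_ i x \in
              (orthov (g (imm x)) (screen x) :&:
               orthov (g (imm x)) (screen_transversal x))%VS,
            forall i j, g (imm x) (xi i x) (N_ j x) = (i == j)%:R
          & forall i j, g (imm x) (N_ i x) (N_ j x) = 0])]
}.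

Section Gauss.
Variables (R : realType) (m d : nat) (M : manifold R m) (N : manifold R d).
Variables (g : N -> {symmetric 'rV[R]_d}) (L : lightlike_submanifold M g).

Definition transversal_bundle : bundle d M :=
  fun p => (ltr L p + screen_transversal L p)%VS.

Definition gauss_formula (D nab hl hs : along_op d M) : Prop :=
  forall X Y, is_section (imm L) (TM L) X -> is_section (imm L) (TM L) Y ->
  [/\ is_section (imm L) (TM L) (nab X Y),
      is_section (imm L) (ltr L) (hl X Y),
      is_section (imm L) (screen_transversal L) (hs X Y)
    & forall p, D X Y p = nab X Y p + hl X Y p + hs X Y p].

(* [nab X Y] is the TM-component of [D X Y] in TM (+) tr(TM). *)
Definition tangential_component (D nab : along_op d M) : Prop :=
  forall X Y, is_section (imm L) (TM L) X -> is_section (imm L) (TM L) Y ->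
  is_section (imm L) (TM L) (nab X Y) /\
  is_section (imm L) transversal_bundle (fun p => D X Y p - nab X Y p).

Definition totally_geodesic_foliation (nab : along_op d M) (E : bundle d M) :
    Prop :=
  forall X Y, is_section (imm L) E X -> is_section (imm L) E Y ->
  is_section (imm L) E (nab X Y).

End Gauss.

Section ContactCR.
Variables (R : realType) (n q m : nat) (Mbar : manifold R n.*2.+1).
Variables (S : kenmotsu_statistical Mbar q) (M : manifold R m).
Variable L : lightlike_submanifold M (metric S).

Definition phi_img (E : bundle n.*2.+1 M) : bundle n.*2.+1 M :=
  fun p => (phi S (imm L p) @: E p)%VS.

Definition phi_along (Y : M -> 'rV[R]_(n.*2.+1)) : M -> 'rV[R]_(n.*2.+1) :=
  fun p => phi S (imm L p) (Y p).

Definition nu_line : bundle n.*2.+1 M := fun p => <[nu S (imm L p)]>%VS.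

Record contact_CR_lightlike := ContactCRLightlike {
  D0 : bundle n.*2.+1 M ;
  D' : bundle n.*2.+1 M ;
  L1 : bundle n.*2.+1 M ;
  nu_tangent : forall p, nu S (imm L p) \in TM L p ;
  Rad_phiRad : forall p, (Rad L p :&: phi_img (Rad L) p = 0)%VS ;
  phiRad_tangent : forall p, (phi_img (Rad L) p <= TM L p)%VS ;
  phiRad_subbundle : subbundle (imm L) (phi_img (Rad L)) ;
  D0_subbundle : subbundle (imm L) D0 ;
  D'_subbundle : subbundle (imm L) D' ;
  screen_decomp : forall p,
    screen L p = (phi_img (Rad L) p + D' p + D0 p + nu_line p)%VS ;
  screen_direct : forall p,
    directv (phi_img (Rad L) p + D' p + D0 p + nu_line p) ;
  screen_orth_D0 : forall p,
    (phi_img (Rad L) p + D' p <= orthov (metric S (imm L p)) (D0 p))%VS ;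
  screen_orth_nu : forall p,
    (phi_img (Rad L) p + D' p + D0 p <=
       orthov (metric S (imm L p)) (nu_line p))%VS ;
  phi_D0 : forall p, phi_img D0 p = D0 p ;
  D0_nondegenerate : forall p,
    (D0 p :&: orthov (metric S (imm L p)) (D0 p) = 0)%VS ;
  L1_subbundle : subbundle (imm L) L1 ;
  L1_sub : forall p, (L1 p <= screen_transversal L p)%VS ;
  phi_D' : forall p, phi_img D' p = (L1 p + ltr L p)%VS ;
  phi_D'_direct : forall p, directv (L1 p + ltr L p) ;
  phi_D'_orth : forall p,
    (L1 p <= orthov (metric S (imm L p)) (ltr L p))%VS
}.

(* D _|_ {nu}, with D = Rad(TM) _|_ phi(Rad(TM)) _|_ D0 *)
Definition D_nu (C : contact_CR_lightlike) : bundle n.*2.+1 M :=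
  fun p => (Rad L p + phi_img (Rad L) p + D0 C p + nu_line p)%VS.

End ContactCR.

(* Main.v *)
From HB Require Import structures.
Require Import Defs.
From mathcomp Require Import all_boot all_order all_algebra.
From mathcomp Require Import all_classical all_reals all_analysis.
From mathcomp Require Import ring lra.

(** Write D^ for the mean of the two induced connections (the Levi-Civita
    connection along M) and h^l, h^s for its transversal parts, that is, the means
    of the second fundamental forms. Two facts carry the proof.

    The first is pointwise linear algebra: a tangent vector Z lies in D + <nu> if
    and only if it is orthogonal to phi(Rad) and to phi(L1)
    ([mem_D_nu_of_orthogonal], [D_nu_perp_phi_Rad], [D_nu_perp_phi_L1]). Indeed
    phi(D') is the sum of L1 and ltr; the products with phi(Rad) detect the
    ltr-part of phi Z, and those with phi(L1) detect its L1-part.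

    The second is the structure equation
      D^_X(phi Y) = phi(D^_X Y) + eta(Y) phi X - g(phi X, Y) nu.
    For X and Y in D + <nu> its last two terms are orthogonal to Rad, to L1 and to
    phi(L1). As phi is skew, moving it across the metric and through D^ yields, for
    v in Rad and l in L1,
      g(D^_X Y, phi v) = - g(h^l(X, phi Y), v)      ([nabhat_dot_phi_Rad]),
      g(D^_X Y, phi l) = - g(h^s(X, phi Y), l)      ([nabhat_dot_phi_L1]),
      g(h^s(X, Y), l) = g(D^_X(phi Y), phi l)       ([second_form_dot_L1]).
    On the left of the first two, D^_X Y can be replaced by its tangential
    component, because phi v and phi l lie in the screen distribution. Since
    phi Y again lies in D + <nu>, the first two equations show that the conditions
    imply that the foliation is totally geodesic, and the first and the third give
    the converse.

    Two points require analysis. The structure equation is given for fields on the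
    ambient manifold and is needed for fields along M; it is transferred by
    expanding a field along M on global fields of the ambient manifold
    ([exists_frame_expansion], [induced_endo_commutator]). The two conditions speak
    of global sections, whereas the linear algebra needs vectors at a point
    ([exists_section]). Both rest on smooth bump functions ([exists_bump]), hence
    on the flatness of exp(-1/t) at 0 and on the stability of C^k maps under sums,
    products, inverses and compositions. *)

Set Implicit Arguments.
Unset Strict Implicit.
Unset Printing Implicit Defensive.
Import Order.TTheory GRing.Theory Num.Theory.
Import numFieldNormedType.Exports.
Local Open Scope classical_set_scope.
Local Open Scope ring_scope.


(** * Calculus of C^k maps *)

(** The differential is characterised by the first-order expansion, in which the
    error committed when one map replaces the other vanishes near the point. *)
Lemma near_eq_diff (R : numFieldType) (V W : normedModType R) (f g : V -> W) x :
  (\near x, f x = g x) -> differentiable f x ->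
  differentiable g x /\ ('d g x = 'd f x :> (V -> W)).
Proof.
move=> fg df.
have dfc : continuous ('d f x) by exact: diff_continuous.
have e : g \o shift x = cst (g x) + 'd f x +o_ (0 : V) id.
  apply/eqaddoP => eps eps0.
  have := diff_locally df => /eqaddoP/(_ _ eps0).
  have fgx : f x = g x by exact: nbhs_singleton fg.
  move: fg; rewrite (near_shift (0 : V)) subr0.
  by apply: filterS2 => y /= fgy; rewrite !fctE /= -fgy -fgx.
have dgE := diff_unique dfc e.
split; last exact: dgE.
by apply/diff_locallyP; rewrite dgE.
Qed.

Section CkCalculus.
Variable R : realType.
Implicit Types V W : normedModType R.

Lemma Ck_on_sub V W k (U U' : set V) (f : V -> W) :
  U' `<=` U -> Ck_on k U f -> Ck_on k U' f.
Proof.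
elim: k f => [|k IH] f UU' /=; first by move=> h x /UU'; exact: h.
move=> [h1 h2]; split; first by move=> x /UU'; exact: h1.
by move=> v; exact: IH.
Qed.

(** All conditions in the definition of C^k are conditions at the points of the
    set, so any covering of the set suffices, even by sets that are not open. *)
Lemma Ck_on_local V W k (U : set V) (f : V -> W) :
  (forall x, U x -> exists2 U' : set V, U' x & Ck_on k U' f) -> Ck_on k U f.
Proof.
elim: k f => [|k IH] f /= h.
  by move=> x /h[U' U'x]; exact.
split; first by move=> x /h[U' U'x []] + _; exact.
by move=> v; apply: IH => x /h[U' U'x [_ h']]; exists U'.
Qed.

(** Openness is essential here: the differentials of both maps have to agree at
    each point of the set, which needs equality in a neighbourhood. *)
Lemma Ck_on_eq V W k (U : set V) (f g : V -> W) :
  open U -> (forall x, U x -> f x = g x) -> Ck_on k U f -> Ck_on k U g.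
Proof.
move=> Uo; elim: k f g => [|k IH] f g fg /=.
  move=> h x Ux; have fgn : \near x, f x = g x.
    by apply: filterS (open_nbhs_nbhs (conj Uo Ux)); exact: fg.
  suff: g @ x --> g x by [].
  rewrite -(fg _ Ux).
  exact: cvg_trans (near_eq_cvg fgn) (h x Ux).
move=> [h1 h2].
have fgd x : U x -> differentiable g x /\ ('d g x = 'd f x :> (V -> W)).
  move=> Ux; apply: near_eq_diff (h1 x Ux).
  by apply: filterS (open_nbhs_nbhs (conj Uo Ux)); exact: fg.
split=> [x /fgd[] //|v].
apply: IH (h2 v) => x Ux.
by have [_ /(congr1 (@^~ v)) /= ->] := fgd x Ux.
Qed.

Lemma Ck_onS V W k (U : set V) (f : V -> W) : Ck_on k.+1 U f -> Ck_on k U f.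
Proof.
elim: k f => [|k IH] f; first by move=> [h _] x /h/differentiable_continuous.
by move=> [h1 h2]; split=> // v; apply: IH.
Qed.

Lemma Ck_on_cst V W k (U : set V) (c : W) : Ck_on k U (fun=> c).
Proof.
elim: k c => [|k IH] c /=; first by move=> x _; exact: cst_continuous.
split=> [x _|v]; first exact: differentiable_cst.
have -> : (fun x : V => 'd (fun=> c) x v) = fun=> 0; last exact: IH.
by apply/funext => x; rewrite (@diff_cst _ V W c x).
Qed.

Lemma Ck_on_linear V W k (U : set V) (f : {linear V -> W}) :
  continuous f -> Ck_on k U f.
Proof.
move=> fc; case: k => [|k] /=; first by move=> x _; exact: fc.
split=> [x _|v]; first exact: linear_differentiable.
have -> : (fun x : V => 'd f x v) = fun=> f v; last exact: Ck_on_cst.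
by apply/funext => x; rewrite (diff_lin _ fc).
Qed.

Lemma Ck_onD V W k (U : set V) (f g : V -> W) :
  open U -> Ck_on k U f -> Ck_on k U g -> Ck_on k U (fun x => f x + g x).
Proof.
move=> Uo; elim: k f g => [|k IH] f g /=.
  by move=> hf hg x Ux; apply: continuousD; [exact: hf|exact: hg].
move=> [f1 f2] [g1 g2]; split=> [x Ux|v].
  by apply: differentiableD; [exact: f1|exact: g1].
apply: Ck_on_eq Uo _ (IH _ _ (f2 v) (g2 v)) => x Ux.
exact: esym (congr1 (@^~ v) (diffD (f1 x Ux) (g1 x Ux))).
Qed.

Lemma Ck_onZl V W k (U : set V) (f : V -> R) (w : W) :
  open U -> Ck_on k U f -> Ck_on k U (fun x => f x *: w).
Proof.
move=> Uo; elim: k f => [|k IH] f /=.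
  move=> hf x Ux; exact: (@cvgZr_tmp R W V (nbhs x) _ f (f x) w (hf x Ux)).
move=> [f1 f2]; split=> [x Ux|v].
  exact: differentiableZl (f1 x Ux).
apply: Ck_on_eq (IH _ (f2 v)) => // x Ux.
have -> // : 'd (fun y => f y *: w) x = (fun z => 'd f x z *: w) :> (V -> W).
exact: diffZl (f1 x Ux).
Qed.

Lemma Ck_onM V k (U : set V) (f g : V -> R) :
  open U -> Ck_on k U f -> Ck_on k U g -> Ck_on k U (fun x => f x * g x).
Proof.
move=> Uo; elim: k f g => [|k IH] f g.
  by move=> hf hg x Ux; apply: continuousM; [exact: hf|exact: hg].
move=> hf hg; have [f1 f2] := hf; have [g1 g2] := hg; split=> [x Ux|v].
  by apply: differentiableM; [exact: f1|exact: g1].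
have := Ck_onD Uo (IH _ _ (Ck_onS hf) (g2 v)) (IH _ _ (f2 v) (Ck_onS hg)).
apply: Ck_on_eq => // x Ux.
apply: etrans (esym (congr1 (@^~ v) (diffM (f1 x Ux) (g1 x Ux)))).
by congr (_ + _); exact: mulrC.
Qed.

Lemma Ck_onV V k (U : set V) (f : V -> R) :
  open U -> (forall x, U x -> f x != 0) -> Ck_on k U f ->
  Ck_on k U (fun x => (f x)^-1).
Proof.
move=> Uo f0; elim: k => [|k IH] hf.
  by move=> x Ux; apply: continuousV; [exact: f0|exact: hf].
have [f1 f2] := hf; split=> [x Ux|v].
  by apply: differentiableV; [exact: f1|exact: f0].
have hV := IH (Ck_onS hf).
have h := Ck_onM Uo (@Ck_on_cst V R k U (-1 : R))
  (Ck_onM Uo (f2 v) (Ck_onM Uo hV hV)).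
apply: Ck_on_eq Uo _ h => x Ux.
apply: etrans (esym (congr1 (@^~ v) (diffV (f1 x Ux) (f0 x Ux)))).
by rewrite /= expr2 invfM mulN1r scaleNr [_ *: _]mulrC.
Qed.

Lemma Ck_on_sum V W k (U : set V) I (r : seq I) (f : I -> V -> W) :
  open U -> (forall i, Ck_on k U (f i)) -> Ck_on k U (fun x => \sum_(i <- r) f i x).
Proof.
move=> Uo h; elim: r => [|i r IH].
  apply: Ck_on_eq (Ck_on_cst k U 0) => // x _; by rewrite big_nil.
apply: Ck_on_eq (Ck_onD Uo (h i) IH) => // x _; by rewrite big_cons.
Qed.

Lemma diff_linear_comp V V' W (f : V -> V') (c : {linear V' -> W}) x :
  continuous c -> differentiable f x ->
  differentiable (c \o f) x /\ ('d (c \o f) x = c \o 'd f x :> (V -> W)).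
Proof.
move=> cc df; have dc := linear_differentiable (f x) cc.
split; first exact: differentiable_comp df dc.
by rewrite (diff_comp df dc) (diff_lin (f x) cc).
Qed.

Lemma Ck_on_linear_comp V V' W k (U : set V) (f : V -> V')
    (c : {linear V' -> W}) :
  open U -> continuous c -> Ck_on k U f -> Ck_on k U (fun x => c (f x)).
Proof.
move=> Uo cc; elim: k f => [|k IH] f.
  by move=> hf x Ux; apply: continuous_comp (hf x Ux) (cc _).
move=> [f1 f2]; split=> [x Ux|v]; first by have [] := diff_linear_comp cc (f1 x Ux).
apply: Ck_on_eq Uo _ (IH _ (f2 v)) => x Ux.
by have [_ /(congr1 (fun h => h v))] := diff_linear_comp cc (f1 x Ux).
Qed.

(** The chain rule gives d(g o f)(v) = dg(df(v)), in which both the base point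
    and the argument of dg vary. Expanding df(v) on a basis e turns this into a
    sum of products of the scalar functions c_i(df(v)) and of the derivatives of
    g in the fixed directions e_i, so that induction on k applies. *)
Lemma Ck_on_comp_scalar V V' k (U : set V) (U' : set V') (f : V -> V')
    (g : V' -> R) n (c : 'I_n -> {linear V' -> R}) (e : 'I_n -> V') :
  (forall i, continuous (c i)) -> (forall v, v = \sum_i c i v *: e i) ->
  open U -> open U' -> (forall x, U x -> U' (f x)) ->
  Ck_on k U f -> Ck_on k U' g -> Ck_on k U (g \o f).
Proof.
move=> cc cE Uo Uo' UU'; elim: k g => [|k IH] g.
  by move=> hf hg x Ux; apply: continuous_comp (hf x Ux) (hg _ (UU' x Ux)).
move=> hf [g1 g2]; have [f1 f2] := hf; split=> [x Ux|v].
  exact: differentiable_comp (f1 x Ux) (g1 _ (UU' x Ux)).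
have h : Ck_on k U (fun x => \sum_i c i ('d f x v) * ('d g (f x) (e i))).
  apply: Ck_on_sum => // i; apply: Ck_onM => //.
    exact: Ck_on_linear_comp (f2 v).
  exact: IH (Ck_onS hf) (g2 (e i)).
apply: Ck_on_eq Uo _ h => x Ux.
have -> : 'd (g \o f) x = 'd g (f x) \o 'd f x :> (V -> R).
  exact: diff_comp (f1 x Ux) (g1 _ (UU' x Ux)).
rewrite /= [in RHS](cE ('d f x v)) linear_sum.
by apply: eq_bigr => i _; rewrite linearZ.
Qed.

End CkCalculus.

(** Packaged as a linear form, so that the lemmas on linear maps apply to the
    coordinates. *)
Definition coordl (R : realType) n (i : 'I_n) (v : 'rV[R]_n) : R := v 0 i.

Lemma coordl_is_linear (R : realType) n (i : 'I_n) :
  linear (@coordl R n i : 'rV[R]_n -> R^o).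
Proof. by move=> a u v; rewrite /coordl !mxE. Qed.
HB.instance Definition _ (R : realType) n (i : 'I_n) :=
  GRing.isLinear.Build R 'rV[R]_n R _ (@coordl R n i) (@coordl_is_linear R n i).

Lemma coordl_continuous (R : realType) n (i : 'I_n) : continuous (@coordl R n i).
Proof. by move=> v; exact: coord_continuous. Qed.

Lemma coordlE (R : realType) n (v : 'rV[R]_n) :
  v = \sum_i coordl i v *: delta_mx 0 i.
Proof. exact: row_sum_delta. Qed.

Section CkRow.
Variables (R : realType).

Lemma Ck_on_rowP (V : normedModType R) d k (U : set V) (f : V -> 'rV[R]_d) :
  open U -> Ck_on k U f <-> forall i, Ck_on k U (fun x => f x 0 i).
Proof.
move=> Uo; split=> h.
  move=> i; exact: (@Ck_on_linear_comp R V _ _ k U f (@coordl R d i) Uo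
    (@coordl_continuous R d i) h).
apply: (Ck_on_eq (f := fun x => \sum_i f x 0 i *: delta_mx 0 i) Uo).
  by move=> x _; rewrite [in RHS](coordlE (f x)).
by apply: Ck_on_sum => // i; apply: Ck_onZl.
Qed.

Lemma Ck_onZ (V : normedModType R) d k (U : set V) (a : V -> R)
    (f : V -> 'rV[R]_d) :
  open U -> Ck_on k U a -> Ck_on k U f -> Ck_on k U (fun x => a x *: f x).
Proof.
move=> Uo ha /(Ck_on_rowP _ _ Uo) hf; apply/(Ck_on_rowP _ _ Uo) => i.
by apply: Ck_on_eq (Ck_onM Uo ha (hf i)) => // x _; rewrite mxE.
Qed.

(** A finite expansion on continuous coordinate forms: the only consequence of
    finite dimension that the composition of C^k maps uses. It treats row spaces
    and the real line uniformly. *)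
Definition fin_coord (W : normedModType R) : Prop :=
  exists n (c : 'I_n -> {linear W -> R}) (e : 'I_n -> W),
    (forall i, continuous (c i)) /\ (forall w, w = \sum_i c i w *: e i).

Lemma fin_coord_row d : fin_coord 'rV[R]_d.
Proof.
exists d, (fun i => @coordl R d i), (fun i => delta_mx 0 i).
by split; [exact: coordl_continuous|exact: coordlE].
Qed.

Lemma fin_coord_real : fin_coord R.
Proof.
exists 1, (fun=> idfun), (fun=> 1); split; first by move=> _ x; exact: cvg_id.
by move=> w; rewrite big_ord1 /= [RHS]mulr1.
Qed.

Lemma Ck_on_comp (V V' W : normedModType R) k (U : set V) (U' : set V')
    (f : V -> V') (g : V' -> W) :
  fin_coord V' -> fin_coord W ->
  open U -> open U' -> (forall x, U x -> U' (f x)) ->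
  Ck_on k U f -> Ck_on k U' g -> Ck_on k U (g \o f).
Proof.
move=> [n [c [e [cc cE]]]] [n' [c' [e' [cc' cE']]]] Uo Uo' UU' hf hg.
apply: (Ck_on_eq (f := fun x => \sum_i c' i (g (f x)) *: e' i) Uo).
  by move=> x _; rewrite -cE'.
apply: Ck_on_sum => // i; apply: Ck_onZl => //.
have hi : Ck_on k U' (fun y => c' i (g y)) by exact: Ck_on_linear_comp hg.
exact: Ck_on_comp_scalar cc cE Uo Uo' UU' hf hi.
Qed.

End CkRow.

(** * The flat function exp(-1/t) *)

Section Flat.
Variable R : realType.
Implicit Types (P : {poly R}) (t s : R).

(** The functions P(1/t) exp(-1/t), extended by 0 to the negative half-line.
    The polynomial factor makes this family stable under derivation. *)
Definition flat_fun P t : R := if 0 < t then P.[t^-1] * expR (- t^-1) else 0.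

(** Quantifying over the rate e makes the induction work: the factor s that a
    new degree brings is absorbed by half of the rate, as s is at most
    2/e * exp(es/2). *)
Lemma poly_le_expR P (e : R) : 0 < e ->
  exists2 C : R, 0 <= C & forall s, 0 <= s -> `|P.[s]| <= C * expR (e * s).
Proof.
elim/poly_ind: P e => [|P c IH] e e0.
  by exists 0 => // s _; rewrite horner0 normr0 mul0r.
have e2 : 0 < e / 2 by rewrite divr_gt0.
have [C C0 hC] := IH _ e2.
exists (C * (e / 2)^-1 + `|c|) => [|s s0].
  by rewrite addr_ge0 // mulr_ge0 // invr_ge0 ltW.
rewrite hornerMXaddC mulrDl; apply: le_trans (ler_normD _ _) _; apply: lerD.
  rewrite normrM (ger0_norm s0).
  have -> : C * (e / 2)^-1 * expR (e * s) =
      (C * expR (e / 2 * s)) * ((e / 2)^-1 * expR (e / 2 * s)).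
    rewrite mulrACA -expRD; congr (_ * expR _); lra.
  apply: ler_pM => //; first exact: hC.
  rewrite mulrC ler_pdivlMr // mulrC.
  by apply: le_trans (expR_ge1Dx _); rewrite lerDr.
rewrite ler_peMr // -expR0 ler_expR; apply: mulr_ge0 => //; exact: ltW.
Qed.

(** Apply the exponential bound to P * 'X at s = 1/t: the additional factor s
    becomes the factor t on the right. *)
Lemma flat_bound P : exists2 C, 0 <= C & forall t, `|flat_fun P t| <= C * `|t|.
Proof.
have [C C0 hC] := poly_le_expR (P * 'X) ltr01.
exists C => // t; rewrite /flat_fun; case: ifPn => t0; last first.
  by rewrite normr0 mulr_ge0.
have := hC _ (ltW (etrans (invr_gt0 t) t0)).
rewrite hornerMX normrM mul1r (gtr0_norm (etrans (invr_gt0 t) t0)).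
rewrite ler_pdivrMr // (gtr0_norm t0) normrM (gtr0_norm (expR_gt0 _)) expRN.
by rewrite ler_pdivrMr ?expR_gt0 // mulrAC.
Qed.

Lemma flat_cvg0 P : flat_fun P t @[t --> 0] --> 0.
Proof.
have [C C0 hC] := flat_bound P.
have C1 : 0 < C + 1 by apply: ltr_wpDl.
apply/cvgr0Pnorm_le => e e0; near=> t.
apply: le_trans (hC t) _.
apply: (@le_trans _ _ ((C + 1) * `|t|)); first by apply: ler_wpM2r => //; lra.
rewrite mulrC -ler_pdivlMr //.
near: t; apply: (@cvgr0_norm_le _ _ _ (nbhs 0) _ id); last exact: divr_gt0.
exact: cvg_id.
Unshelve. all: by end_near. Qed.

Definition flat_deriv P : {poly R} := (P - P^`()) * 'X^2.

(** At the origin the difference quotient of the function of P is the function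
    of P * 'X, hence it tends to 0. *)
Lemma is_derive_flat P t : is_derive t 1 (flat_fun P) (flat_fun (flat_deriv P) t).
Proof.
have [t0|t0|->] := ltrgtP t 0.
- rewrite [X in is_derive _ _ _ X]/flat_fun ltNge (ltW t0) /=.
  apply: (@near_eq_is_derive _ _ _ (cst 0)).
  near=> x; rewrite /flat_fun ltNge ifF //; apply/negbTE; rewrite negbK ltW //.
  by near: x; exact: lt_nbhsl.
- rewrite [X in is_derive _ _ _ X]/flat_fun t0.
  pose F (x : R) := P.[x^-1] * expR (- x^-1).
  apply: (@near_eq_is_derive _ _ _ F).
    near=> x; rewrite /flat_fun /F ifT //; near: x; exact: lt_nbhsr.
  have tn0 : t != 0 by rewrite gt_eqF.
  have dV : is_derive t 1 (fun y : R => y^-1) (- t ^- 2).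
    apply: is_derive_eq (is_deriveV tn0 (is_derive_id t 1)) _.
    by rewrite [LHS]mulr1.
  have dN : is_derive t 1 (fun y : R => - y^-1) (t ^- 2).
    by apply: is_derive_eq (is_deriveN dV) _; rewrite opprK.
  have dP := is_derive1_comp (is_derive_poly P t^-1) dV.
  have dE := @is_derive1_comp R expR (fun y => - y^-1) t _ _
    (is_derive_expR (- t^-1)) dN.
  apply: is_derive_eq (is_deriveM dP dE) _.
  rewrite /flat_deriv !hornerE -exprVn /GRing.scale /=.
  by move: t^-1 (expR _) P^`().[_] P.[_] => s c b a; ring.
- rewrite [X in is_derive _ _ _ X]/flat_fun ltxx.
  have h : h^-1 *: (flat_fun P (h *: 1 + 0) - flat_fun P 0) @[h --> 0^'] --> 0.
    have e : flat_fun (P * 'X) h @[h --> 0^'] --> 0.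
      apply: cvg_within_filter; exact: flat_cvg0.
    apply: cvg_trans e; apply: near_eq_cvg; near=> h.
    rewrite addr0 /flat_fun ltxx subr0 [h *: 1]mulr1.
    case: ifP => _; last by rewrite scaler0.
    by rewrite hornerMX -mulrA mulrCA.
  by apply: DeriveDef; [apply/cvg_ex; exists 0 | exact: cvg_lim h].
Unshelve. all: by end_near. Qed.

Lemma smooth_flat P : smooth_on setT (flat_fun P).
Proof.
move=> k; elim: k P => [|k IH] P.
  move=> t _; apply: differentiable_continuous; apply/derivable1_diffP.
  by have [] := is_derive_flat P t.
have dP t : differentiable (flat_fun P) t.
  by apply/derivable1_diffP; have [] := is_derive_flat P t.
split=> [t _ //|v].
have h : Ck_on k setT (fun t => flat_fun (flat_deriv P) t * v).
  exact: Ck_onM openT (IH _) (@Ck_on_cst R _ _ k setT v).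
apply: Ck_on_eq openT _ h => t _.
rewrite -[in RHS](mulr1 v) linearZ /= -deriveE //.
by have [_ ->] := is_derive_flat P t; rewrite mulrC.
Qed.

Lemma flat_gt0 t : 0 < t -> 0 < flat_fun 1 t.
Proof. by move=> t0; rewrite /flat_fun t0 hornerC mul1r expR_gt0. Qed.

Lemma flat_le0 P t : t <= 0 -> flat_fun P t = 0.
Proof. by rewrite /flat_fun ltNge => ->. Qed.

End Flat.

(** * Smooth functions and bump functions on a manifold *)

Lemma open_preimage_in (S T : topologicalType) (f : S -> T) (A : set S)
    (B : set T) :
  open A -> open B -> (forall x, A x -> {for x, continuous f}) ->
  open [set x | A x /\ B (f x)].
Proof.
move=> Ao Bo fc; rewrite openE => x [Ax Bfx]; apply: filterI.
  exact: open_nbhs_nbhs.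
exact: (fc x Ax) (open_nbhs_nbhs (conj Bo Bfx)).
Qed.

Section SmoothMaps.
Variables (R : realType) (d : nat) (M : manifold R d).
Implicit Types (W : normedModType R) (U A K : set M) (p : M).

Definition chart_img i : set 'rV[R]_d := chart M i @` chart_dom M i.

Lemma chart_imgP i x : chart_img i x ->
  chart_dom M i (chart_inv M i x) /\ chart M i (chart_inv M i x) = x.
Proof. by move=> [p ip <-]; rewrite chartK. Qed.

(** Described through the inverse chart rather than as an image, so that openness
    and inclusions are immediate; [local_imgE] gives the description as an image. *)
Definition local_img i U : set 'rV[R]_d :=
  [set x | chart_img i x /\ U (chart_inv M i x)].

Lemma local_imgE i U : local_img i U = chart M i @` (chart_dom M i `&` U).
Proof.
apply/seteqP; split => [x [xi Ux]|_ [p [ip Up] <-]].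
  by have [? <-] := chart_imgP xi; exists (chart_inv M i x).
by split; [exists p|rewrite chartK].
Qed.

Lemma open_local_img i U : open U -> open (local_img i U).
Proof.
move=> Uo; apply: open_preimage_in => //; first exact: open_chart_img.
exact: chart_inv_continuous.
Qed.

(** Smoothness on a subset of the manifold, tested in every chart. It is the
    common form to which smoothness of functions, of vector fields and of vector
    fields along an immersion is reduced below. *)
Definition msmooth_on W U (F : M -> W) : Prop :=
  forall i, smooth_on (local_img i U) (F \o chart_inv M i).

Lemma msmooth_on_sub W U U' (F : M -> W) :
  U' `<=` U -> msmooth_on U F -> msmooth_on U' F.
Proof.
by move=> UU' h i k; apply: Ck_on_sub (h i k) => x [? /UU' ?].
Qed.

Lemma msmooth_on_local W U (F : M -> W) :
  (forall p, U p -> exists2 U', U' p & msmooth_on U' F) -> msmooth_on U F.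
Proof.
move=> h i k; apply: Ck_on_local => x [xi /h[U' U'x hU']].
by exists (local_img i U'); [split|exact: hU'].
Qed.

Lemma msmooth_on_eq W U (F G : M -> W) :
  open U -> (forall p, U p -> F p = G p) -> msmooth_on U F -> msmooth_on U G.
Proof.
move=> Uo FG h i k; apply: Ck_on_eq (h i k); first exact: open_local_img.
by move=> x [_ Ux]; exact: FG.
Qed.

Lemma msmooth_on_cst W U (c : W) : msmooth_on U (fun=> c).
Proof. by move=> i k; exact: Ck_on_cst. Qed.

Lemma msmooth_onD W U (F G : M -> W) :
  open U -> msmooth_on U F -> msmooth_on U G -> msmooth_on U (fun p => F p + G p).
Proof.
by move=> Uo hF hG i k; apply: Ck_onD (hF i k) (hG i k); exact: open_local_img.
Qed.

Lemma msmooth_onM U (F G : M -> R) :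
  open U -> msmooth_on U F -> msmooth_on U G -> msmooth_on U (fun p => F p * G p).
Proof.
by move=> Uo hF hG i k; apply: Ck_onM (hF i k) (hG i k); exact: open_local_img.
Qed.

Lemma msmooth_onZ e U (a : M -> R) (F : M -> 'rV[R]_e) :
  open U -> msmooth_on U a -> msmooth_on U F -> msmooth_on U (fun p => a p *: F p).
Proof.
by move=> Uo ha hF i k; apply: Ck_onZ (ha i k) (hF i k); exact: open_local_img.
Qed.

Lemma msmooth_onV U (F : M -> R) :
  open U -> (forall p, U p -> F p != 0) -> msmooth_on U F ->
  msmooth_on U (fun p => (F p)^-1).
Proof.
move=> Uo F0 hF i k; apply: (Ck_onV _ _ (hF i k)); first exact: open_local_img.
by move=> x [_]; exact: F0.
Qed.

Lemma msmooth_on_coord e U (F : M -> 'rV[R]_e) l :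
  open U -> msmooth_on U F -> msmooth_on U (fun p => F p 0 l).
Proof.
move=> Uo hF i k.
by have /(Ck_on_rowP _ _ (open_local_img (i := i) Uo)) := hF i k; exact.
Qed.

Lemma msmooth_on_comp e W U (U' : set 'rV[R]_e) (F : M -> 'rV[R]_e)
    (g : 'rV[R]_e -> W) :
  fin_coord W -> open U -> open U' -> (forall p, U p -> U' (F p)) ->
  msmooth_on U F -> smooth_on U' g -> msmooth_on U (g \o F).
Proof.
move=> Wfin Uo Uo' UU' hF hg i k.
apply: (Ck_on_comp (@fin_coord_row R e) Wfin (open_local_img (i := i) Uo) Uo' _
  (hF i k) (hg k)).
by move=> x [_]; exact: UU'.
Qed.

Lemma smooth_chart j : msmooth_on (chart_dom M j) (chart M j).
Proof. by move=> i; rewrite local_imgE; exact: chart_transition. Qed.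

(** Other charts differ by the transition maps, so one chart is enough. *)
Lemma msmooth_on_in_chart W j U (F : M -> W) :
  fin_coord W -> open U -> U `<=` chart_dom M j ->
  smooth_on (local_img j U) (F \o chart_inv M j) -> msmooth_on U F.
Proof.
move=> Wfin Uo Uj hF.
have h : msmooth_on U ((F \o chart_inv M j) \o chart M j).
  apply: (msmooth_on_comp Wfin Uo (open_local_img (i := j) Uo) _ _ hF).
    by move=> p Up; split; [exists p => //; exact: Uj|rewrite chartK //; exact: Uj].
  exact: msmooth_on_sub (smooth_chart j).
by apply: msmooth_on_eq h => // p Up /=; rewrite chartK //; exact: Uj.
Qed.

Lemma msmooth_on_setT W (F : M -> W) :
  (forall i, smooth_on (chart_img i) (F \o chart_inv M i)) <-> msmooth_on setT F.
Proof.
by split=> h i k; apply: Ck_on_sub (h i k) => x; [case|split].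
Qed.

Lemma smooth_funP (f : M -> R) : smooth_fun f <-> msmooth_on setT f.
Proof. exact: msmooth_on_setT. Qed.

(** Away from the closed set K the product is the zero map, so F may be
    arbitrary outside U. *)
Lemma msmooth_on_extend0 e A U K (b : M -> R) (F : M -> 'rV[R]_e) :
  open A -> open U -> closed K -> K `<=` U -> (forall p, ~ K p -> b p = 0) ->
  msmooth_on A b -> msmooth_on (A `&` U) F -> msmooth_on A (fun p => b p *: F p).
Proof.
move=> Ao Uo Kc KU b0 hb hF; apply: msmooth_on_local => p Ap.
have [Kp|nKp] := pselect (K p).
  exists (A `&` U); first by split=> //; exact: KU.
  apply: (msmooth_onZ (openI Ao Uo)) => //.
  by apply: msmooth_on_sub hb => q [].
exists (~` K) => //; apply: (msmooth_on_eq (closed_openC Kc) _ (msmooth_on_cst _ 0)).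
by move=> q nKq; rewrite b0 // scale0r.
Qed.

Lemma msmooth_on_continuous W U (F : M -> W) p :
  open U -> U p -> msmooth_on U F -> {for p, continuous F}.
Proof.
move=> Uo Up hF; pose i := chart_at M p.
have ip : chart_dom M i p := mem_chart_at p.
have c0 : {for chart M i p, continuous (F \o chart_inv M i)}.
  by apply: (hF i 0%N); split; [exists p|rewrite chartK].
suff : F @ p --> F p by [].
have e : \near p, ((F \o chart_inv M i) \o chart M i) p = F p.
  apply: filterS (open_nbhs_nbhs (conj (@open_chart_dom _ _ M i) ip)) => q iq /=.
  by rewrite chartK.
apply: cvg_trans (near_eq_cvg e) _.
have := continuous_comp (chart_continuous ip) c0.
by rewrite /prop_for /continuous_at /= chartK.
Qed.

End SmoothMaps.

Section Bump.
Variables (R : realType).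

(** A product of one-variable bumps rather than a radial function: its support
    is a cube, which fits the sup norm of row vectors. *)
Definition cube_bump d (x0 : 'rV[R]_d) (r : R) (x : 'rV[R]_d) : R :=
  \prod_i flat_fun 1 (r ^+ 2 - (x 0 i - x0 0 i) ^+ 2).

Lemma smooth_cube_bump d (x0 : 'rV[R]_d) r : smooth_on setT (cube_bump x0 r).
Proof.
move=> k.
have h (s : seq 'I_d) : Ck_on k setT (fun x : 'rV[R]_d =>
    \prod_(i <- s) flat_fun 1 (r ^+ 2 - (x 0 i - x0 0 i) ^+ 2)).
  elim: s => [|i s IH].
    apply: Ck_on_eq openT _ (@Ck_on_cst R 'rV[R]_d R k setT 1) => x _.
    by rewrite big_nil.
  have hi : Ck_on k setT (fun x : 'rV[R]_d => x 0 i - x0 0 i).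
    apply: Ck_onD openT _ (@Ck_on_cst R 'rV[R]_d R k setT _).
    exact: (@Ck_on_linear R _ _ k setT (@coordl R d i) (@coordl_continuous R d i)).
  have hi2 : Ck_on k setT (fun x : 'rV[R]_d =>
      r ^+ 2 + (-1) * ((x 0 i - x0 0 i) * (x 0 i - x0 0 i))).
    apply: (Ck_onD openT (@Ck_on_cst R 'rV[R]_d R k setT _)).
    apply: (Ck_onM openT (@Ck_on_cst R 'rV[R]_d R k setT _)).
    exact (Ck_onM openT hi hi).
  have hf := Ck_on_comp (@fin_coord_real R) (@fin_coord_real R) openT openT
    (fun=> fun=> I) hi2 (smooth_flat 1 k).
  apply: Ck_on_eq openT _ (Ck_onM openT hf IH) => x _.
  by rewrite big_cons /= mulN1r -expr2.
exact: h.
Qed.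

Lemma cube_bump_center d (x0 : 'rV[R]_d) r : 0 < r -> cube_bump x0 r x0 != 0.
Proof.
move=> r0; apply/prodf_neq0 => i _.
by rewrite subrr expr0n subr0 gt_eqF // flat_gt0 // exprn_gt0.
Qed.

Definition cube d (x0 : 'rV[R]_d) (r : R) : set 'rV[R]_d :=
  [set x | forall i, `[x0 0 i - r, x0 0 i + r]%classic (x 0 i)].

Lemma compact_cube d (x0 : 'rV[R]_d) r : compact (cube x0 r).
Proof.
apply: (@rV_compact R d (fun i => `[x0 0 i - r, x0 0 i + r]%classic)) => i.
exact: segment_compact.
Qed.

Lemma cube_sub_ball d (x0 : 'rV[R]_d) r e : r < e -> 0 < e ->
  cube x0 r `<=` ball x0 e.
Proof.
move=> re e0 x xr; split=> // i j; rewrite ord1 /ball /=.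
have := xr j; rewrite /= in_itv /= => /andP[h1 h2].
by apply: le_lt_trans re; rewrite ler_distlC; apply/andP; split; lra.
Qed.

Lemma cube_bump_out d (x0 : 'rV[R]_d) r x : 0 < r ->
  ~ cube x0 r x -> cube_bump x0 r x = 0.
Proof.
move=> r0 xr; apply: contrapT => /eqP/prodf_neq0 h; apply: xr => i.
have := h i isT; rewrite /= in_itv /=.
have [|+ _] := leP (r ^+ 2 - (x 0 i - x0 0 i) ^+ 2) 0.
  by move=> /(flat_le0 1) ->; rewrite eqxx.
rewrite subr_gt0 => h1; have : `|x 0 i - x0 0 i| <= r.
  by rewrite -ler_sqr ?nnegrE ?(ltW r0) // real_normK ?num_real // ltW.
by rewrite ler_norml => /andP[h2 h3]; apply/andP; split; lra.
Qed.

(** The bump is written in the preferred chart of p and extended by 0. The set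
    K is the image of a closed cube under the inverse chart: it is compact, hence
    closed because the manifold is Hausdorff, and the extension is smooth across
    the boundary of the chart domain. *)
Lemma exists_bump d (M : manifold R d) (p : M) (U : set M) : open U -> U p ->
  exists (b : M -> R) (K : set M), [/\ msmooth_on setT b, b p = 1, closed K,
    K `<=` U & forall q, ~ K q -> b q = 0].
Proof.
move=> Uo Up; set i := chart_at M p; set x0 := chart M i p.
have ip : chart_dom M i p := mem_chart_at p.
have : nbhs x0 (local_img i U).
  apply: open_nbhs_nbhs; split; first exact: open_local_img.
  by split; [exists p|rewrite /x0 chartK].
move=> /nbhs_ballP[e e0 eU]; pose r := e / 2.
have r0 : 0 < r by rewrite divr_gt0.
have cU : cube x0 r `<=` local_img i U.
  apply: subset_trans eU; apply: cube_sub_ball => //.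
  by rewrite /r ltr_pdivrMr // ltr_pMr // ltr1n.
pose K := chart_inv M i @` cube x0 r.
have Kdom q : K q -> chart_dom M i q.
  by move=> [x /cU[/chart_imgP[]] ? _ _ <-].
pose b q := if `[<chart_dom M i q>] then cube_bump x0 r (chart M i q) else 0.
have bK q : ~ K q -> b q = 0.
  rewrite /b; case: asboolP => // iq Kq; apply: cube_bump_out => // qr.
  by apply: Kq; exists (chart M i q) => //; rewrite chartK.
have Kc : closed K.
  apply: compact_closed; first exact: manifold_hausdorff.
  apply: continuous_compact; last exact: compact_cube.
  apply: continuous_in_subspaceT => x; rewrite inE => /cU[xi _].
  exact: chart_inv_continuous.
have bp : b p != 0.
  by rewrite /b asboolT //; exact: cube_bump_center.
have bs : msmooth_on setT b.
  apply: msmooth_on_local => q _; have [Kq|nKq] := pselect (K q).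
    exists (chart_dom M i); first exact: Kdom.
    apply: (@msmooth_on_eq _ _ _ _ _ (cube_bump x0 r \o chart M i)).
    - exact: open_chart_dom.
    - by move=> q' iq' /=; rewrite /b asboolT.
    apply: (msmooth_on_comp (@fin_coord_real R) _ openT); last exact: smooth_cube_bump.
    - exact: open_chart_dom.
    - by [].
    exact: smooth_chart.
  exists (~` K) => //; apply: (msmooth_on_eq (closed_openC Kc) _ (msmooth_on_cst _ 0)).
    by move=> q' /bK.
exists (fun q => (b p)^-1 * b q), K; split => //.
- by apply: msmooth_onM => //; [exact: openT|exact: (@msmooth_on_cst _ _ M R)].
- by rewrite mulVf.
- by move=> q [x /cU[_ Ux] <-].
- by move=> q /bK ->; rewrite mulr0.
Qed.
End Bump.

(** * Tangent coordinates and global vector fields *)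

Section RowDiff.
Variable K : numFieldType.

(** The differential between row spaces, with the normed module structures fixed
    once for all. *)
Definition rdiff d e (f : 'rV[K]_d -> 'rV[K]_e) x v : 'rV[K]_e := 'd f x v.

Lemma rdiff_comp d e h (f : 'rV[K]_d -> 'rV[K]_e) (g : 'rV[K]_e -> 'rV[K]_h)
    x v :
  differentiable f x -> differentiable g (f x) ->
  rdiff (g \o f) x v = rdiff g (f x) (rdiff f x v).
Proof. by move=> df dg; rewrite /rdiff (diff_comp df dg). Qed.

Lemma near_eq_rdiff d e (f g : 'rV[K]_d -> 'rV[K]_e) x v :
  (\near x, f x = g x) -> differentiable f x ->
  differentiable g x /\ rdiff g x v = rdiff f x v.
Proof.
move=> fg df; have [dg e'] := near_eq_diff fg df; split; first exact: dg.
exact: (congr1 (fun h => h v) e').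
Qed.

Lemma rdiff_id d (x v : 'rV[K]_d) : rdiff id x v = v.
Proof.
have idc : continuous (idfun : 'rV[K]_d -> 'rV[K]_d) by move=> y; exact: cvg_id.
by rewrite /rdiff (diff_lin (f := idfun) x idc).
Qed.

Lemma differentiable_row_id d (x : 'rV[K]_d) : differentiable id x.
Proof. exact: (@ex_diff _ _ _ _ _ _ _ (is_diff_id x)). Qed.

End RowDiff.

Section Tangent.
Variables (R : realType) (d : nat) (M : manifold R d).
Implicit Types (p : M) (v w : 'rV[R]_d).

Definition dtransition i j p v : 'rV[R]_d :=
  rdiff (chart M j \o chart_inv M i) (chart M i p) v.

Lemma tcoordE j p v : tcoord j p v = dtransition (chart_at M p) j p v.
Proof. by []. Qed.

Lemma differentiable_transition i j p : chart_dom M i p -> chart_dom M j p ->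
  differentiable (chart M j \o chart_inv M i) (chart M i p).
Proof.
move=> ip jp; have [h _] := @chart_transition _ _ M i j 1.
by apply: h; exists p.
Qed.

Lemma near_chart_img i p (U : set M) : open U -> U p -> chart_dom M i p ->
  \forall x \near chart M i p, local_img i U x.
Proof.
move=> Uo Up ip; apply: open_nbhs_nbhs; split; first exact: open_local_img.
by split; [exists p|rewrite chartK].
Qed.

(** The cocycle rule for the differentials of the transition maps. *)
Lemma dtransition_comp i j k p v :
  chart_dom M i p -> chart_dom M j p -> chart_dom M k p ->
  dtransition j k p (dtransition i j p v) = dtransition i k p v.
Proof.
move=> ip jp kp; rewrite /dtransition.
have dij := differentiable_transition ip jp.
have djk := differentiable_transition jp kp.
have e : (chart M j \o chart_inv M i) (chart M i p) = chart M j p.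
  by rewrite /= chartK.
have djk' : differentiable (chart M k \o chart_inv M j)
   ((chart M j \o chart_inv M i) (chart M i p)) by rewrite e.
have c := rdiff_comp v dij djk'.
have n : \forall x \near chart M i p,
    ((chart M k \o chart_inv M j) \o (chart M j \o chart_inv M i)) x =
    (chart M k \o chart_inv M i) x.
  apply: filterS (near_chart_img (open_chart_dom (m := M) j) jp ip) => x [_ jx] /=.
  by rewrite chartK.
have [_ h] := near_eq_rdiff v n (differentiable_comp dij djk').
rewrite -[X in rdiff _ X _ = _]e.
apply: etrans (esym c) _.
exact: esym h.
Qed.

Lemma dtransition_id i p v : chart_dom M i p -> dtransition i i p v = v.
Proof.
move=> ip; rewrite /dtransition.
have n : \forall x \near chart M i p, x = (chart M i \o chart_inv M i) x.
  apply: filterS (near_chart_img openT I ip) => x [xi _] /=.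
  by have [_ ->] := chart_imgP xi.
have [_ h] := near_eq_rdiff v n (differentiable_row_id _).
apply: etrans h _; exact: rdiff_id.
Qed.

(** Inverse of the coordinate map [tcoord i p]. *)
Definition vec_of_tcoord i p v : 'rV[R]_d := dtransition i (chart_at M p) p v.

Lemma tcoord_vec_of_tcoord i j p v : chart_dom M i p -> chart_dom M j p ->
  tcoord j p (vec_of_tcoord i p v) = dtransition i j p v.
Proof.
by move=> ip jp; rewrite tcoordE dtransition_comp //; exact: mem_chart_at.
Qed.

Lemma vec_of_tcoordK i p v : chart_dom M i p -> vec_of_tcoord i p (tcoord i p v) = v.
Proof.
move=> ip; rewrite /vec_of_tcoord tcoordE dtransition_comp //; try exact: mem_chart_at.
by rewrite dtransition_id //; exact: mem_chart_at.
Qed.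

Lemma tcoordD j p v w : tcoord j p (v + w) = tcoord j p v + tcoord j p w.
Proof. exact: linearD. Qed.
Lemma tcoordZ j p a v : tcoord j p (a *: v) = a *: tcoord j p v.
Proof. exact: linearZ. Qed.
Lemma tcoord0 j p : tcoord j p (0 : 'rV[R]_d) = 0 :> 'rV[R]_d.
Proof. exact: linear0. Qed.

(** A vector field has smooth components in the chart j as a function on the
    manifold, not only when it is read in that same chart. *)
Lemma smooth_vfieldP (X : M -> 'rV[R]_d) :
  smooth_vfield X <->
  forall j, msmooth_on (chart_dom M j) (fun p => tcoord j p (X p)).
Proof.
split=> h j.
  apply: (@msmooth_on_in_chart _ _ _ _ j).
  - exact: fin_coord_row.
  - exact: open_chart_dom.
  - by [].
  by move=> k; apply: Ck_on_sub (h j k) => x [].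
move=> k; apply: Ck_on_sub (h j j k) => x xi; split=> //.
by have [] := chart_imgP xi.
Qed.

Lemma smooth_dtransition i j v :
  msmooth_on (chart_dom M i `&` chart_dom M j) (fun p => dtransition i j p v).
Proof.
pose U := chart_dom M i `&` chart_dom M j.
have Uo : open U by apply: openI; exact: open_chart_dom.
apply: (@msmooth_on_eq _ _ _ _ _
   ((fun x => rdiff (chart M j \o chart_inv M i) x v) \o chart M i)) => //.
apply: (@msmooth_on_comp _ _ _ _ _ _ (local_img i U)) => //.
- exact: fin_coord_row.
- exact: open_local_img.
- by move=> p [ip jp]; split; [exists p|rewrite chartK].
- by apply: msmooth_on_sub (smooth_chart i) => p [].
move=> k; rewrite local_imgE setIA setIid.
have [_] := @chart_transition _ _ M i j k.+1; exact.
Qed.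

(** The coordinate field of the chart i with constant components v, cut off by
    b to make it global. *)
Definition cutoff_field (b : M -> R) i v : M -> 'rV[R]_d :=
  fun p => b p *: vec_of_tcoord i p v.

Lemma smooth_cutoff_field (b : M -> R) i v K :
  msmooth_on setT b -> closed K -> K `<=` chart_dom M i ->
  (forall p, ~ K p -> b p = 0) -> smooth_vfield (cutoff_field b i v).
Proof.
move=> bs Kc Ki b0; apply/smooth_vfieldP => j.
have jo := @open_chart_dom _ _ M j; have io := @open_chart_dom _ _ M i.
have h : msmooth_on (chart_dom M j) (fun p => b p *: tcoord j p (vec_of_tcoord i p v)).
  apply: (msmooth_on_extend0 jo io Kc) => //; first exact: msmooth_on_sub bs.
  apply: (@msmooth_on_eq _ _ _ _ _ (fun p => dtransition i j p v)).
  - exact: openI.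
  - by move=> p [jp ip]; rewrite tcoord_vec_of_tcoord.
  by apply: msmooth_on_sub (smooth_dtransition i j v) => p [].
by apply: msmooth_on_eq h => // p jp; rewrite /cutoff_field tcoordZ.
Qed.

Lemma exists_vfield p v : exists2 X : M -> 'rV[R]_d, smooth_vfield X & X p = v.
Proof.
set i := chart_at M p; have ip : chart_dom M i p := mem_chart_at p.
have [b [K [bs bp Kc Ki b0]]] := exists_bump (@open_chart_dom _ _ M i) ip.
exists (cutoff_field b i v); first exact: smooth_cutoff_field b0.
by rewrite /cutoff_field bp scale1r /vec_of_tcoord dtransition_id.
Qed.

End Tangent.

(** * Vector fields along an immersion *)

Section AlongMap.
Variables (R : realType) (m d : nat) (M : manifold R m) (N : manifold R d).
Variables (imm : M -> N) (imm_smooth : smooth_map imm).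
Implicit Types (U : set M) (V : M -> 'rV[R]_d) (p : M).

Lemma open_imm_pre (B : set N) : open B -> open (imm @^-1` B).
Proof. by move=> Bo; apply: open_comp => // x _; exact: imm_smooth.1. Qed.

Lemma open_imm_dom j : open (imm @^-1` chart_dom N j).
Proof. by apply: open_imm_pre; exact: open_chart_dom. Qed.

Lemma smooth_imm_chart j : msmooth_on (imm @^-1` chart_dom N j) (chart N j \o imm).
Proof. by move=> i; rewrite local_imgE; exact: imm_smooth.2. Qed.

Lemma msmooth_on_pullback (W : normedModType R) (B : set N) (F : N -> W) :
  fin_coord W -> open B -> msmooth_on B F -> msmooth_on (imm @^-1` B) (F \o imm).
Proof.
move=> Wfin Bo hF; apply: msmooth_on_local => p Bp.
set j := chart_at N (imm p).
have jp : chart_dom N j (imm p) := mem_chart_at (imm p).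
have Uo : open (imm @^-1` (chart_dom N j `&` B)).
  by apply: open_imm_pre; apply: openI => //; exact: open_chart_dom.
exists (imm @^-1` (chart_dom N j `&` B)); first by split.
apply: (@msmooth_on_eq _ _ _ _ _ ((F \o chart_inv N j) \o (chart N j \o imm))) => //.
  by move=> q [jq _] /=; rewrite chartK.
apply: (msmooth_on_comp Wfin Uo (open_local_img (i := j) Bo)).
- by move=> q [jq Bq]; split; [exists (imm q)|rewrite /= chartK].
- by apply: msmooth_on_sub (smooth_imm_chart j) => q [].
- exact: hF.
Qed.

(** The two conditions differ only in the order in which the sets are
    intersected. *)
Lemma smooth_alongP U V :
  smooth_along imm U V <->
  forall j, msmooth_on (U `&` imm @^-1` chart_dom N j)
              (fun p => tcoord j (imm p) (V p)).
Proof.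
split=> h.
  move=> j i; rewrite local_imgE setIA [_ `&` U]setIC; exact: h.
move=> i j; have := h j i.
by rewrite local_imgE setIA [_ `&` U]setIC.
Qed.

Lemma smooth_along_sub U U' V :
  U' `<=` U -> smooth_along imm U V -> smooth_along imm U' V.
Proof.
move=> UU' /smooth_alongP h; apply/smooth_alongP => j.
by apply: msmooth_on_sub (h j) => p [/UU' ? ?].
Qed.

Lemma smooth_along_local U V :
  (forall p, U p -> exists2 U', U' p & smooth_along imm U' V) ->
  smooth_along imm U V.
Proof.
move=> h; apply/smooth_alongP => j; apply: msmooth_on_local => p [/h[U' U'p] + jp].
by move=> /smooth_alongP h'; exists (U' `&` imm @^-1` chart_dom N j).
Qed.

Lemma smooth_along_eq U V V' :
  open U -> (forall p, U p -> V p = V' p) ->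
  smooth_along imm U V -> smooth_along imm U V'.
Proof.
move=> Uo VV' /smooth_alongP h; apply/smooth_alongP => j.
apply: msmooth_on_eq (h j); first by apply: openI => //; exact: open_imm_dom.
by move=> p [/VV' -> _].
Qed.

Lemma smooth_along0 U : smooth_along imm U (fun=> 0).
Proof.
apply/smooth_alongP => j.
have -> : (fun p => tcoord j (imm p) 0) = fun=> 0.
  by apply/funext => p; exact: tcoord0.
exact: msmooth_on_cst.
Qed.

Lemma smooth_alongD U V V' : open U -> smooth_along imm U V ->
  smooth_along imm U V' -> smooth_along imm U (fun p => V p + V' p).
Proof.
move=> Uo /smooth_alongP h /smooth_alongP h'; apply/smooth_alongP => j.
have Uj := openI Uo (open_imm_dom j).
by apply: msmooth_on_eq (msmooth_onD Uj (h j) (h' j)) => // p _; rewrite tcoordD.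
Qed.

Lemma smooth_alongZ U (a : M -> R) V : open U -> msmooth_on U a ->
  smooth_along imm U V -> smooth_along imm U (fun p => a p *: V p).
Proof.
move=> Uo ha /smooth_alongP h; apply/smooth_alongP => j.
have Uj := openI Uo (open_imm_dom j).
have ha' : msmooth_on (U `&` imm @^-1` chart_dom N j) a.
  by apply: msmooth_on_sub ha => p [].
by apply: msmooth_on_eq (msmooth_onZ Uj ha' (h j)) => // p _; rewrite tcoordZ.
Qed.

Lemma smooth_along_sum U I (r : seq I) (F : I -> M -> 'rV[R]_d) :
  open U -> (forall i, smooth_along imm U (F i)) ->
  smooth_along imm U (fun p => \sum_(i <- r) F i p).
Proof.
move=> Uo h; elim: r => [|i r IH].
  by apply: smooth_along_eq (smooth_along0 U) => // p _; rewrite big_nil.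
by apply: smooth_along_eq (smooth_alongD Uo (h i) IH) => // p _; rewrite big_cons.
Qed.

Lemma smooth_along_restrict (X : N -> 'rV[R]_d) : smooth_vfield X ->
  smooth_along imm setT (fun p => X (imm p)).
Proof.
move=> /smooth_vfieldP h; apply/smooth_alongP => j.
have jo := @open_chart_dom _ _ N j.
apply: msmooth_on_sub (msmooth_on_pullback (@fin_coord_row R d) jo (h j)).
by move=> p [].
Qed.

Lemma smooth_along_extend0 U K (b : M -> R) V :
  open U -> closed K -> K `<=` U -> (forall p, ~ K p -> b p = 0) ->
  msmooth_on setT b -> smooth_along imm U V ->
  smooth_along imm setT (fun p => b p *: V p).
Proof.
move=> Uo Kc KU b0 hb hV; apply: smooth_along_local => p _.
have [Kp|nKp] := pselect (K p).
  exists U; first exact: KU.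
  by apply: smooth_alongZ hV => //; apply: msmooth_on_sub hb.
exists (~` K) => //.
apply: smooth_along_eq (smooth_along0 _); first exact: closed_openC.
by move=> q nKq; rewrite b0 // scale0r.
Qed.

(** With a bump c at the image of p, supported in a chart of N, take for E the
    coordinate fields of that chart cut off by c, and for f the components of V
    multiplied by c. All of them are global and smooth, and the sum of the
    f_k E_k is c^2 V; this is the reason for b = c^2. *)
Lemma exists_frame_expansion V p : smooth_along imm setT V ->
  exists (b : M -> R) (f : 'I_d -> M -> R) (E : 'I_d -> N -> 'rV[R]_d),
    [/\ smooth_fun b, b p = 1, forall k, smooth_fun (f k),
        forall k, smooth_vfield (E k)
      & forall q, b q *: V q = \sum_k f k q *: E k (imm q)].
Proof.
move=> /smooth_alongP hV; set i := chart_at N (imm p).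
have ip : chart_dom N i (imm p) := mem_chart_at (imm p).
have [c [K [cs cp Kc Ki c0]]] := exists_bump (@open_chart_dom _ _ N i) ip.
have ds : msmooth_on setT (c \o imm).
  exact: msmooth_on_pullback (@fin_coord_real R) openT cs.
have Vs : msmooth_on setT (fun q => c (imm q) *: tcoord i (imm q) (V q)).
  apply: (@msmooth_on_extend0 _ _ _ _ setT (imm @^-1` chart_dom N i)
    (imm @^-1` K)) ds (hV i).
  - exact: openT.
  - exact: open_imm_dom.
  - by apply: closed_comp Kc => q _; exact: imm_smooth.1.
  - by move=> q /Ki.
  - by move=> q /c0.
pose f k q := (c (imm q) *: tcoord i (imm q) (V q)) 0 k.
exists (fun q => c (imm q) * c (imm q)), f,
  (fun k => cutoff_field c i (delta_mx 0 k)); split.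
- by apply/smooth_funP; apply: (msmooth_onM openT ds ds).
- by rewrite cp mulr1.
- by move=> k; apply/smooth_funP; exact: msmooth_on_coord openT Vs.
- by move=> k; exact: smooth_cutoff_field c0.
move=> q; rewrite /cutoff_field /f; have [Kq|nKq] := pselect (K (imm q)); last first.
  by rewrite c0 // mulr0 scale0r big1 // => k _; rewrite mxE mul0r scale0r.
have iq := Ki _ Kq; rewrite -{1}(vec_of_tcoordK (V q) iq).
rewrite [tcoord i (imm q) (V q) in LHS]coordlE /vec_of_tcoord /dtransition /rdiff.
rewrite linear_sum scaler_sumr.
apply: eq_bigr => k _; rewrite linearZ /= !scalerA mxE; congr (_ *: _).
by rewrite -mulrA [_ * c _]mulrC.
Qed.

(** A is only known to preserve smooth fields on N. Near p one has
    V = b^-1 sum_k f_k E_k, and A is applied to the fields E_k. *)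
Lemma smooth_along_endo (A : N -> 'End('rV[R]_d)) V :
  (forall X, smooth_vfield X -> smooth_vfield (fun q => A q (X q))) ->
  smooth_along imm setT V -> smooth_along imm setT (fun p => A (imm p) (V p)).
Proof.
move=> hA hV; apply: smooth_along_local => p _.
have [b [f [E [bs bp fs Es VE]]]] := exists_frame_expansion p hV.
move/smooth_funP: bs => bs.
have bc : continuous b by move=> q; exact: msmooth_on_continuous openT I bs.
pose U := [set q | b q != 0].
have Uo : open U.
  apply: (open_comp (f := b) (D := [set x : R | x != 0])).
    by move=> q _; exact: bc.
  exact: open_neq.
exists U; first by rewrite /U /= bp oner_neq0.
apply: (@smooth_along_eq _
  (fun q => (b q)^-1 *: \sum_k f k q *: A (imm q) (E k (imm q)))) => //.
  move=> q bq; rewrite -[V q](scalerK bq) VE linearZ /=; congr (_ *: _).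
  rewrite linear_sum.
  by apply: eq_bigr => k _; rewrite linearZ.
apply: smooth_alongZ => //.
  by apply: msmooth_onV => //; exact: msmooth_on_sub bs.
apply: smooth_along_sum => // k; apply: smooth_alongZ => //.
  by have /smooth_funP := fs k; exact: msmooth_on_sub.
apply: smooth_along_sub (smooth_along_restrict (hA _ (Es k))).
by [].
Qed.

(** Conditions on all global sections can thus be tested on vectors at a point:
    a constant combination of a local frame is multiplied by a bump function. *)
Lemma exists_section (E : bundle d M) p v : subbundle imm E -> v \in E p ->
  exists2 V, is_section imm E V & V p = v.
Proof.
move=> /(_ p)[U [Uo Up [k [e [es eb]]]]] vE.
have [b [K [bs bp Kc KU b0]]] := exists_bump Uo Up.
pose c i := coord [tuple e i p | i < k] i v.
exists (fun q => b q *: \sum_i c i *: e i q).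
  split.
    apply: (smooth_along_extend0 Uo Kc KU b0 bs).
    apply: smooth_along_sum => // i; apply: smooth_alongZ => //.
    exact: (@msmooth_on_cst _ _ M R).
  move=> q; have [Kq|nKq] := pselect (K q); last by rewrite b0 // scale0r mem0v.
  apply: memvZ; apply: memv_suml => i _; apply: memvZ.
  apply: (basis_mem (eb q (KU q Kq))).
  by apply/tnthP; exists i; rewrite tnth_mktuple.
rewrite bp scale1r [RHS](coord_basis (eb p Up) vE).
by apply: eq_bigr => i _; rewrite -tnth_nth tnth_mktuple.
Qed.

End AlongMap.

(** * Induced connections *)

Lemma scale_half_double (R : realType) (V : lmodType R) (v : V) :
  2^-1 *: (v + v) = v.
Proof.
rewrite -{1 2}[v]scale1r -scalerDl scalerA -[1 + 1]/(2%:R).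
by rewrite mulVf ?scale1r // pnatr_eq0.
Qed.

Section InducedConnection.
Variables (R : realType) (m d : nat) (M : manifold R m) (N : manifold R d).
Variables (imm : M -> N) (imm_smooth : smooth_map imm).
Notation TMb := (tangent_bundle imm).
Notation section := (is_section imm (@full_bundle R m d M)).

Lemma full_sectionP V : section V <-> smooth_along imm setT V.
Proof. by split=> [[]//|h]; split=> // p; rewrite memvf. Qed.

Lemma tangent_bundleP p w :
  w \in TMb p -> exists v, Defs.pushforward imm p v = w.
Proof. by move=> /memv_imgP[v _ ->]; exists v; rewrite lfunE. Qed.

(** The derivative term of the Leibniz rule is kept because the two weights 1/2
    add up to 1. *)
Lemma mean_induced_connection (nab nabs : vfield_op N) (D Ds : along_op d M) :
  induced_connection imm nab D -> induced_connection imm nabs Ds ->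
  induced_connection imm (mean_op nab nabs) (mean_along D Ds).
Proof.
move=> hD hDs; split.
- move=> X Y hX hY; apply/full_sectionP.
  have /full_sectionP h1 := ind_smooth hD hX hY.
  have /full_sectionP h2 := ind_smooth hDs hX hY.
  apply: (smooth_alongZ imm_smooth openT (@msmooth_on_cst _ _ M R _ _)).
  exact: smooth_alongD openT h1 h2.
- move=> X X' Y hX hX' hY p; rewrite /mean_along.
  by rewrite (indDl hD) // (indDl hDs) // addrACA scalerDr.
- move=> f X Y hf hX hY p; rewrite /mean_along.
  by rewrite (indZl hD) // (indZl hDs) // -scalerDr !scalerA mulrC.
- move=> X Y Y' hX hY hY' p; rewrite /mean_along.
  by rewrite (indDr hD) // (indDr hDs) // addrACA scalerDr.
- move=> f X Y hf hX hY p v hv; rewrite /mean_along.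
  rewrite (ind_leibniz hD hf hX hY hv) (ind_leibniz hDs hf hX hY hv).
  rewrite addrACA scalerDr -(scalerDr (f p)) scalerA [2^-1 * _]mulrC -scalerA.
  by rewrite scale_half_double.
- move=> X Xb Yb hX hXb hYb p hp; rewrite /mean_along /mean_op.
  by rewrite (ind_restrict hD hX hXb hYb hp) (ind_restrict hDs hX hXb hYb hp).
Qed.

Section Commutator.
Variables (nab : vfield_op N) (D : along_op d M).
Hypothesis (hD : induced_connection imm nab D).

Lemma induced_sum X p I (r : seq I) (F : I -> M -> 'rV[R]_d) :
  is_section imm TMb X -> (forall i, section (F i)) ->
  D X (fun q => \sum_(i <- r) F i q) p = \sum_(i <- r) D X (F i) p.
Proof.
move=> hX hF.
have s0 : section (fun=> 0) by apply/full_sectionP; exact: smooth_along0.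
have hs (s : seq I) : section (fun q => \sum_(i <- s) F i q).
  apply/full_sectionP; apply: smooth_along_sum => // [|i]; first exact: openT.
  by apply/full_sectionP.
elim: r => [|i r IH].
  rewrite big_nil; have := indDr hD hX s0 s0 p.
  have e : (fun q : M => 0 + 0) = fun=> 0 :> 'rV[R]_d.
    by apply/funext => q; rewrite addr0.
  have e' : (fun q => \sum_(i <- [::]) F i q) = fun=> 0.
    by apply/funext => q; rewrite big_nil.
  by rewrite e e' => /(congr1 (fun z => z - D X (fun=> 0) p)); rewrite subrr addrK.
rewrite big_cons -IH -(indDr hD hX (hF i) (hs r)).
by congr (D X _ p); apply/funext => q; rewrite big_cons.
Qed.

(** The difference D_X(AY) - A(D_X Y) only depends on Y p: both terms contain the
    derivatives of the components of Y in the same way. Hence it can be computed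
    from the commutators of nab with A on a frame of fields of N. Expanding
    b Y = sum_k f_k E_k and applying the Leibniz rule to both sides gives the
    formula, once for A and once for the identity. *)
Lemma induced_endo_commutator (A : N -> 'End('rV[R]_d)) X Y p :
  (forall Z, smooth_vfield Z -> smooth_vfield (fun q => A q (Z q))) ->
  is_section imm TMb X -> section Y ->
  forall Xb, smooth_vfield Xb -> Xb (imm p) = X p ->
  exists (c : 'I_d -> R) (E : 'I_d -> N -> 'rV[R]_d),
  [/\ forall k, smooth_vfield (E k), Y p = \sum_k c k *: E k (imm p) &
    D X (fun q => A (imm q) (Y q)) p - A (imm p) (D X Y p) =
    \sum_k c k *: (nab Xb (fun q => A q (E k q)) (imm p)
                   - A (imm p) (nab Xb (E k) (imm p)))].
Proof.
move=> hA hX /full_sectionP hY Xb hXb Xp.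
have [b [f [E [bs bp fs Es YE]]]] := exists_frame_expansion imm_smooth p hY.
have hAY := smooth_along_endo imm_smooth hA hY.
have [v hv] := tangent_bundleP (hX.2 p).
have secE k : section (fun q => E k (imm q)).
  by apply/full_sectionP; exact: smooth_along_restrict.
have expand (B : N -> 'End('rV[R]_d)) :
    (forall Z, smooth_vfield Z -> smooth_vfield (fun q => B q (Z q))) ->
    section (fun q => B (imm q) (Y q)) ->
    dirder p v b *: B (imm p) (Y p) + D X (fun q => B (imm q) (Y q)) p =
    \sum_k (dirder p v (f k) *: B (imm p) (E k (imm p)) +
            f k p *: nab Xb (fun q => B q (E k q)) (imm p)).
  move=> hB sBY.
  have := ind_leibniz hD bs hX sBY hv; rewrite bp scale1r => <-.
  have -> : (fun q => b q *: B (imm q) (Y q)) =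
      fun q => \sum_k f k q *: B (imm q) (E k (imm q)).
    apply/funext => q; rewrite -linearZ /= YE linear_sum.
    by apply: eq_bigr => k _; rewrite linearZ.
  have sBE k : section (fun q => B (imm q) (E k (imm q))).
    by apply/full_sectionP; exact: smooth_along_restrict (hB _ (Es k)).
  rewrite induced_sum //; last first.
    move=> k; apply/full_sectionP.
    apply: (smooth_alongZ imm_smooth openT); first by apply/smooth_funP.
    by apply/full_sectionP.
  apply: eq_bigr => k _.
  rewrite (ind_leibniz hD (fs k) hX (sBE k) hv); congr (_ + _ *: _).
  exact: (ind_restrict hD hX hXb (hB _ (Es k)) Xp).
have eA := expand A hA (proj2 (full_sectionP _) hAY).
have eI := expand (fun=> \1%VF).
exists (fun k => f k p), E; split=> //.
  by rewrite -YE bp scale1r.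
have idE (Z : N -> 'rV[R]_d) : (fun q => \1%VF (Z q)) = Z.
  by apply/funext => q; rewrite id_lfunE.
have idM (Z : M -> 'rV[R]_d) : (fun q => \1%VF (Z q)) = Z.
  by apply/funext => q; rewrite id_lfunE.
have {}eI : dirder p v b *: Y p + D X Y p =
    \sum_k (dirder p v (f k) *: E k (imm p) + f k p *: nab Xb (E k) (imm p)).
  have := eI _ _; rewrite idM id_lfunE => ->.
  - by apply: eq_bigr => k _; rewrite id_lfunE idE.
  - by move=> Z; rewrite idE.
  - by apply/full_sectionP.
move/(congr1 (A (imm p))): eI.
rewrite linearD linear_sum linearZ /= => eI.
have -> : D X (fun q => A (imm q) (Y q)) p - A (imm p) (D X Y p) =
  (dirder p v b *: A (imm p) (Y p) + D X (fun q => A (imm q) (Y q)) p) -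
  (dirder p v b *: A (imm p) (Y p) + A (imm p) (D X Y p)).
  by rewrite opprD addrACA subrr add0r.
rewrite eA eI -sumrB; apply: eq_bigr => k _.
by rewrite linearD !linearZ /= opprD addrACA subrr add0r scalerBr.
Qed.
End Commutator.
End InducedConnection.

Section KenmotsuAlong.
Variables (R : realType) (n q m : nat) (Mbar : manifold R n.*2.+1).
Variables (S : kenmotsu_statistical Mbar q) (M : manifold R m).
Variables (imm : M -> Mbar) (imm_smooth : smooth_map imm).
Variables (D Ds : along_op n.*2.+1 M).
Hypothesis (HD : induced_connection imm (conn S) D).
Hypothesis (HDs : induced_connection imm (dconn S) Ds).

(** The structure equation of the Kenmotsu manifold holds for the induced mean
    connection, although X and Y are only defined along M: by the previous
    commutator formula, and because its right-hand side is linear in Y p. *)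
Lemma kenmotsu_along X Y p :
  is_section imm (tangent_bundle imm) X -> smooth_along imm setT Y ->
  mean_along D Ds X (fun r => phi S (imm r) (Y r)) p =
  phi S (imm p) (mean_along D Ds X Y p)
  + eta S (imm p) (Y p) *: phi S (imm p) (X p)
  - metric S (imm p) (phi S (imm p) (X p)) (Y p) *: nu S (imm p).
Proof.
move=> hX hY.
have hm := mean_induced_connection imm_smooth HD HDs.
have [Xb hXb Xp] := exists_vfield (imm p) (X p).
have [c [E [hE Yp e]]] := induced_endo_commutator imm_smooth hm
  (@phi_smooth _ _ _ _ S) hX (proj2 (full_sectionP _ _) hY) hXb Xp.
suff e' : mean_along D Ds X (fun r => phi S (imm r) (Y r)) p -
    phi S (imm p) (mean_along D Ds X Y p) =
    eta S (imm p) (Y p) *: phi S (imm p) (X p)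
    - metric S (imm p) (phi S (imm p) (X p)) (Y p) *: nu S (imm p).
  by rewrite -addrA -e' addrCA subrr addr0.
apply: etrans e _.
rewrite Yp linear_sum linear_sumr !scaler_suml -sumrB; apply: eq_bigr => k _.
have := @kenmotsu_phi _ _ _ _ S _ _ hXb (hE k) (imm p); rewrite /lc_conn => ->.
by rewrite Xp [eta _ _ (_ *: _)]linearZ linearZr_LR /= scalerBr !scalerA.
Qed.

End KenmotsuAlong.

(** * Pointwise algebra of contact CR-lightlike submanifolds *)

Section ContactCRAlgebra.
Variables (R : realType) (n q m : nat) (Mbar : manifold R n.*2.+1).
Variables (S : kenmotsu_statistical Mbar q) (M : manifold R m).
Variables (L : lightlike_submanifold M (metric S)) (C : contact_CR_lightlike L).
Variable p : M.
Notation V := 'rV[R]_(n.*2.+1).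
Notation g := (metric S (imm L p)).
Notation ph := (phi S (imm L p)).
Notation et := (eta S (imm L p)).
Notation nup := (nu S (imm L p)).

Lemma metricC (u v : V) : g u v = g v u.
Proof. by rewrite hermC expr0 mul1r. Qed.

Lemma metric_phiN (u v : V) : g (ph u) v = - g u (ph v).
Proof. by apply/eqP; rewrite -addr_eq0; apply/eqP; exact: phi_skew. Qed.

Lemma eta_nu : et nup = 1.
Proof. by rewrite -metric_nu metric_nu_nu. Qed.

(** Since phi^2 nu = 0, applying phi^2 = -id + eta nu to phi nu gives
    phi nu = eta(phi nu) nu, and this coefficient is 0 by skew-symmetry. *)
Lemma phi_nu : ph nup = 0.
Proof.
have h : ph (ph nup) = 0 by rewrite phi_phi eta_nu scale1r addNr.
have h0 : et (ph nup) = 0.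
  have := phi_skew S (imm L p) nup nup; rewrite -metric_nu [X in _ + X]metricC -mulr2n.
  by move=> /eqP; rewrite mulrn_eq0 => /eqP.
have := phi_phi S (imm L p) (ph nup); rewrite h linear0 h0 scale0r addr0.
by move=> /esym/eqP; rewrite oppr_eq0 => /eqP.
Qed.

Lemma Rad_perp u v : u \in Rad L p -> v \in TM L p -> g u v = 0.
Proof. by rewrite memv_cap => /andP[_ /mem_orthovP]; exact. Qed.

Lemma Rad_tangent u : u \in Rad L p -> u \in TM L p.
Proof. by rewrite memv_cap => /andP[]. Qed.

Lemma eta_Rad u : u \in Rad L p -> et u = 0.
Proof. by move=> uR; rewrite -metric_nu Rad_perp //; exact: (nu_tangent C). Qed.

Lemma screen_tangent u : u \in screen L p -> u \in TM L p.
Proof. by have [-> _] := screenP L p; apply: subvP; exact: addvSr. Qed.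

Lemma D'_screen u : u \in D' C p -> u \in screen L p.
Proof.
rewrite (screen_decomp C) => uD; do 2!apply: (subvP (addvSl _ _)).
exact: (subvP (addvSr _ _)).
Qed.

Lemma D0_screen u : u \in D0 C p -> u \in screen L p.
Proof.
rewrite (screen_decomp C) => uD; apply: (subvP (addvSl _ _)).
exact: (subvP (addvSr _ _)).
Qed.

Lemma phiRad_screen u : u \in Rad L p -> ph u \in screen L p.
Proof.
move=> uR; rewrite (screen_decomp C); do 3!apply: (subvP (addvSl _ _)).
exact: memv_img.
Qed.

Lemma D_nuP u : u \in D_nu C p -> exists r s d a,
  [/\ r \in Rad L p, s \in Rad L p, d \in D0 C p &
      u = r + ph s + d + a *: nup].
Proof.
move=> /memv_addP[_ /memv_addP[_ /memv_addP[r rR [_ /memv_imgP[s sR ->] ->]]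
  [d dD ->]] [_ /vlineP[a ->] ->]].
by exists r, s, d, a.
Qed.

Lemma mem_D_nu r s d a : r \in Rad L p -> s \in Rad L p -> d \in D0 C p ->
  r + ph s + d + a *: nup \in D_nu C p.
Proof.
move=> rR sR dD; apply: memv_add; last by apply: memvZ; exact: memv_line.
apply: memv_add => //; apply: memv_add => //; exact: memv_img.
Qed.

Lemma D_nu_tangent u : u \in D_nu C p -> u \in TM L p.
Proof.
move=> /D_nuP[r [s [d [a [rR sR dD ->]]]]].
apply: memvD; last by apply: memvZ; exact: (nu_tangent C).
apply: memvD; last by apply: screen_tangent; exact: D0_screen.
apply: memvD; first exact: Rad_tangent.
by apply: screen_tangent; exact: phiRad_screen.
Qed.

(** phi exchanges Rad and phi(Rad), up to sign because eta vanishes on Rad; it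
    preserves D0 and kills nu. *)
Lemma phi_D_nu u : u \in D_nu C p -> ph u \in D_nu C p.
Proof.
move=> /D_nuP[r [s [d [a [rR sR dD ->]]]]].
have -> : ph (r + ph s + d + a *: nup) = (- s) + ph r + ph d + 0 *: nup.
  rewrite !linearD linearZ /= phi_nu scaler0 phi_phi (eta_Rad sR) !scale0r !addr0.
  by rewrite [_ - s]addrC.
apply: mem_D_nu => //; first by rewrite memvN.
by rewrite -(phi_D0 C); exact: memv_img.
Qed.

Lemma ltr_screen u v : u \in ltr L p -> v \in screen L p -> g u v = 0.
Proof.
have [U [_ Up [xi [N_ [_ /(_ p Up)[_ -> hN _ _]]]]]] := Defs.ltrP L p.
move=> uN vS; suff /subvP/(_ _ uN)/mem_orthovP : (<<[tuple N_ i p | i < rad_rank L]>>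
  <= orthov g (screen L p))%VS by exact.
apply/span_subvP => _ /mapP[i _ ->].
by have := hN i; rewrite memv_cap => /andP[].
Qed.

Lemma ltr_screen_transversal u v :
  u \in ltr L p -> v \in screen_transversal L p -> g u v = 0.
Proof.
have [U [_ Up [xi [N_ [_ /(_ p Up)[_ -> hN _ _]]]]]] := Defs.ltrP L p.
move=> uN vS; suff /subvP/(_ _ uN)/mem_orthovP : (<<[tuple N_ i p | i < rad_rank L]>>
  <= orthov g (screen_transversal L p))%VS by exact.
apply/span_subvP => _ /mapP[i _ ->].
by have := hN i; rewrite memv_cap => /andP[].
Qed.

(** The frame N_i of ltr is dual to a frame of Rad, so the products with Rad are
    the coefficients on the N_i. *)
Lemma ltr_eq0 u : u \in ltr L p -> (forall v, v \in Rad L p -> g v u = 0) ->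
  u = 0.
Proof.
have [U [_ Up [xi [N_ [_ /(_ p Up)[bxi -> _ hd _]]]]]] := Defs.ltrP L p.
move=> /coord_span -> h.
have nE (i : 'I_(rad_rank L)) : [tuple N_ j p | j < rad_rank L]`_i = N_ i p.
  by rewrite -tnth_nth tnth_mktuple.
apply: big1 => i _; rewrite nE.
have xiR : xi i p \in Rad L p.
  by apply: (basis_mem bxi); apply/tnthP; exists i; rewrite tnth_mktuple.
have := h _ xiR; rewrite linear_sumr (bigD1 i) //= big1 ?addr0 => [|j ji].
  rewrite nE linearZr_LR /= hd eqxx mulr1 => ->.
  by rewrite scale0r.
by rewrite nE linearZr_LR /= hd eq_sym (negbTE ji) mulr0.
Qed.

Lemma screen_transversal_perp u v :
  u \in screen_transversal L p -> v \in TM L p -> g u v = 0.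
Proof.
move=> uS vT; suff : u \in TMperp L p by move=> /mem_orthovP; exact.
by have [-> _] := screen_transversalP L p; apply: (subvP (addvSr _ _)).
Qed.

Lemma L1_screen_transversal l : l \in L1 C p -> l \in screen_transversal L p.
Proof. exact: (subvP (L1_sub C p)). Qed.

Lemma eta_L1 l : l \in L1 C p -> et l = 0.
Proof.
move=> /L1_screen_transversal lS; rewrite -metric_nu.
by rewrite screen_transversal_perp //; exact: (nu_tangent C).
Qed.

Lemma phi_phi_L1 l : l \in L1 C p -> ph (ph l) = - l.
Proof. by move=> lL; rewrite phi_phi eta_L1 // scale0r addr0. Qed.

Lemma eta_D' u : u \in D' C p -> et u = 0.
Proof.
move=> uD; rewrite -metric_nu.
have /subvP/(_ u) := screen_orth_nu C p.
rewrite mem_orthov1 => h; apply/eqP; apply: h.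
by apply: (subvP (addvSl _ _)); apply: (subvP (addvSr _ _)).
Qed.

Lemma phi_phi_D' u : u \in D' C p -> ph (ph u) = - u.
Proof. by move=> uD; rewrite phi_phi eta_D' // scale0r addr0. Qed.

(** l = phi d for some d in D', hence phi l = -d. *)
Lemma phi_L1 l : l \in L1 C p -> ph l \in D' C p.
Proof.
move=> lL; have : l \in phi_img L (D' C) p.
  by rewrite phi_D'; apply: (subvP (addvSl _ _)).
by move=> /memv_imgP[u uD ->]; rewrite phi_phi_D' // memvN.
Qed.

Lemma D_nu_perp_phi_L1 u l : u \in D_nu C p -> l \in L1 C p -> g u (ph l) = 0.
Proof.
move=> uD lL; apply/eqP; rewrite -oppr_eq0 -metric_phiN metricC; apply/eqP.
apply: screen_transversal_perp; first exact: L1_screen_transversal.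
by apply: D_nu_tangent; exact: phi_D_nu.
Qed.

Lemma D_nu_perp_phi_Rad u v : u \in D_nu C p -> v \in Rad L p -> g u (ph v) = 0.
Proof.
move=> uD vR; apply/eqP; rewrite -oppr_eq0 -metric_phiN metricC; apply/eqP.
by apply: Rad_perp => //; apply: D_nu_tangent; exact: phi_D_nu.
Qed.

(** Let d be the D'-component of Z, and write phi d = l + n along L1 and ltr.
    The products with phi(Rad) give n = 0, those with phi(L1) say that phi d is
    orthogonal to L1. Then d is orthogonal to each summand of the tangent space,
    so that it lies in Rad; it also lies in the screen distribution, which meets
    Rad trivially. *)
Lemma mem_D_nu_of_orthogonal Z : Z \in TM L p ->
  (forall v, v \in Rad L p -> g Z (ph v) = 0) ->
  (forall l, l \in L1 C p -> g Z (ph l) = 0) -> Z \in D_nu C p.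
Proof.
have [TE Tdir] := screenP L p; rewrite {1}TE (screen_decomp C).
move=> /memv_addP[r rR [_ /memv_addP[_ /memv_addP[_ /memv_addP[_
  /memv_imgP[s sR ->] [d dD ->]] [d0 d0D ->]] [_ /vlineP[a ->] ->]] ->]].
set Z0 := r + ph s + d0 + a *: nup.
have Z0D : Z0 \in D_nu C p by exact: mem_D_nu.
have -> : r + (ph s + d + d0 + a *: nup) = Z0 + d.
  rewrite /Z0 !addrA -(addrA _ d d0) [d + d0]addrC addrA.
  by rewrite -(addrA _ d) [d + _]addrC addrA.
move=> hR hL; suff -> : d = 0 by rewrite addr0.
have dR v : v \in Rad L p -> g (ph d) v = 0.
  move=> vR; rewrite metric_phiN; apply/eqP; rewrite oppr_eq0; apply/eqP.
  by have := hR v vR; rewrite linearDl /= D_nu_perp_phi_Rad // add0r.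
have dL l : l \in L1 C p -> g (ph d) l = 0.
  move=> lL; rewrite metric_phiN; apply/eqP; rewrite oppr_eq0; apply/eqP.
  by have := hL l lL; rewrite linearDl /= D_nu_perp_phi_L1 // add0r.
have : ph d \in phi_img L (D' C) p by exact: memv_img.
rewrite phi_D' => /memv_addP[l lL [nn nN phd]].
have n0 : nn = 0.
  apply: ltr_eq0 => // v vR; rewrite metricC.
  have := dR v vR; rewrite phd linearDl /= screen_transversal_perp ?add0r //.
    exact: L1_screen_transversal.
  exact: Rad_tangent.
move: phd; rewrite n0 addr0 => phd.
have phdT v : v \in TM L p -> g (ph d) v = 0.
  rewrite phd; apply: screen_transversal_perp; exact: L1_screen_transversal.
have dRad : d \in Rad L p.
  rewrite memv_cap; apply/andP; split.
    by apply: screen_tangent; exact: D'_screen.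
  apply/mem_orthovP => v; rewrite -/(TM L p) TE (screen_decomp C).
  move=> /memv_addP[r' r'R [_ /memv_addP[_ /memv_addP[_ /memv_addP[_
    /memv_imgP[s' s'R ->] [d' d'D ->]] [d0' d0'D ->]] [_ /vlineP[a' ->] ->]] ->]].
  have dT : d \in TM L p by apply: screen_tangent; exact: D'_screen.
  rewrite !linearDr linearZr_LR /= [g d r']metricC Rad_perp // metric_nu.
  rewrite eta_D' // mulr0 addr0 add0r.
  have -> : g d (ph s') = 0.
    apply/eqP; rewrite -oppr_eq0 -metric_phiN; apply/eqP; apply: phdT.
    exact: Rad_tangent.
  have -> : g d d0' = 0.
    have /subvP/(_ d) := screen_orth_D0 C p.
    have dd : d \in (phi_img L (Rad L) p + D' C p)%VS.
      exact: (subvP (addvSr _ _)).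
    by move=> /(_ dd)/mem_orthovP; exact.
  rewrite add0r addr0.
  have := metric_phi S (imm L p) d d'; rewrite eta_D' // mul0r subr0 => <-.
  have : ph d' \in phi_img L (D' C) p by exact: memv_img.
  rewrite phi_D' => /memv_addP[l' l'L [n' n'N ->]].
  rewrite linearDr /= dL // add0r phd.
  have /subvP/(_ _ lL)/mem_orthovP := phi_D'_orth C p; exact.
have : d \in (Rad L p :&: screen L p)%VS.
  by rewrite memv_cap dRad D'_screen.
by move: Tdir => /directv_addP ->; rewrite memv0 => /eqP.
Qed.
End ContactCRAlgebra.

(** * The mean connection and the second fundamental forms *)

Section SecondFundamentalForms.
Variables (R : realType) (n q m : nat) (Mbar : manifold R n.*2.+1).
Variables (S : kenmotsu_statistical Mbar q) (M : manifold R m).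
Variables (L : lightlike_submanifold M (metric S)) (C : contact_CR_lightlike L).
Variables (D Ds nab hl hs nabs hls hss nabhat : along_op n.*2.+1 M).
Hypothesis (HD : induced_connection (imm L) (conn S) D).
Hypothesis (HDs : induced_connection (imm L) (dconn S) Ds).
Hypothesis (Hgauss : gauss_formula L D nab hl hs).
Hypothesis (Hgausss : gauss_formula L Ds nabs hls hss).
Hypothesis (Hnabhat : tangential_component L (mean_along D Ds) nabhat).
Notation V := 'rV[R]_(n.*2.+1).
Notation GammaTM := (is_section (imm L) (TM L)).
Notation GammaD := (is_section (imm L) (D_nu C)).
Implicit Types (X Y : M -> V) (p : M) (v l : V).

Lemma imm_smooth : smooth_map (imm L).
Proof. by have [] := immP L. Qed.

Lemma GammaD_tangent X : GammaD X -> GammaTM X.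
Proof. by move=> [hX XD]; split=> // p; exact: D_nu_tangent (XD p). Qed.

Lemma smooth_phi_along Y : smooth_along (imm L) setT Y ->
  smooth_along (imm L) setT (phi_along L Y).
Proof.
by move=> hY; apply: (smooth_along_endo imm_smooth) hY => Z; exact: phi_smooth.
Qed.

Lemma GammaD_phi Y : GammaD Y -> GammaD (phi_along L Y).
Proof.
by move=> [hY YD]; split=> [|p]; [exact: smooth_phi_along|exact: phi_D_nu].
Qed.

Lemma mean_dot_Rad X Y p v : GammaTM X -> GammaTM Y -> v \in Rad L p ->
  metric S (imm L p) (mean_along D Ds X Y p) v =
  2^-1 * (metric S (imm L p) (hls X Y p) v + metric S (imm L p) (hl X Y p) v).
Proof.
move=> hX hY vR; have [h1 _ h3 h4] := Hgauss hX hY.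
have [h1' _ h3' h4'] := Hgausss hX hY.
have vT := Rad_tangent vR.
rewrite /mean_along linearZl_LR /= h4 h4' !linearDl /=.
rewrite (screen_transversal_perp (h3.2 p) vT) (screen_transversal_perp (h3'.2 p) vT).
rewrite ![metric S _ (_ : V) v]metricC.
rewrite (Rad_perp vR (h1.2 p)) (Rad_perp vR (h1'.2 p)) !addr0 !add0r.
by rewrite [X in _ = _ * X]addrC.
Qed.

Lemma mean_dot_screen_transversal X Y p v : GammaTM X -> GammaTM Y ->
  v \in screen_transversal L p ->
  metric S (imm L p) (mean_along D Ds X Y p) v =
  2^-1 * (metric S (imm L p) (hss X Y p) v + metric S (imm L p) (hs X Y p) v).
Proof.
move=> hX hY vS; have [h1 h2 h3 h4] := Hgauss hX hY.
have [h1' h2' h3' h4'] := Hgausss hX hY.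
rewrite /mean_along linearZl_LR /= h4 h4' !linearDl /=.
rewrite (ltr_screen_transversal (h2.2 p) vS) (ltr_screen_transversal (h2'.2 p) vS).
rewrite [metric S _ (nab X Y p) v]metricC [metric S _ (nabs X Y p) v]metricC.
rewrite (screen_transversal_perp vS (h1.2 p)) (screen_transversal_perp vS (h1'.2 p)).
by rewrite !add0r [X in _ = _ * X]addrC.
Qed.

Lemma nabhat_dot_screen X Y p v : GammaTM X -> GammaTM Y -> v \in screen L p ->
  metric S (imm L p) (nabhat X Y p) v =
  metric S (imm L p) (mean_along D Ds X Y p) v.
Proof.
move=> hX hY vS; have [_ [_ /(_ p) h]] := Hnabhat hX hY.
apply/esym/eqP; rewrite -subr_eq0 -linearBl /=; apply/eqP.
move: h => /memv_addP[u uN [w wS ->]].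
rewrite linearDl /= (ltr_screen uN vS).
by rewrite (screen_transversal_perp wS (screen_tangent vS)) addr0.
Qed.

(** The two correction terms of the structure equation are multiples of phi X
    and of nu. *)
Lemma mean_phi_dot X Y p v : GammaTM X -> GammaTM Y ->
  metric S (imm L p) (phi S (imm L p) (X p)) v = 0 ->
  metric S (imm L p) (nu S (imm L p)) v = 0 ->
  metric S (imm L p) (mean_along D Ds X (phi_along L Y) p) v =
  metric S (imm L p) (phi S (imm L p) (mean_along D Ds X Y p)) v.
Proof.
move=> hX hY Xv nuv.
have := kenmotsu_along imm_smooth HD HDs p hX hY.1; rewrite /phi_along => ->.
by rewrite linearBl linearDl !linearZl_LR /= Xv nuv !mulr0 subr0 addr0.
Qed.

(** Move phi to the other factor, then inside the covariant derivative; what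
    remains is the product of D_X(phi Y) with Rad, which only sees ltr. *)
Lemma nabhat_dot_phi_Rad X Y p v : GammaD X -> GammaD Y -> v \in Rad L p ->
  metric S (imm L p) (nabhat X Y p) (phi S (imm L p) v) =
  - (2^-1 * (metric S (imm L p) (hls X (phi_along L Y) p) v +
             metric S (imm L p) (hl X (phi_along L Y) p) v)).
Proof.
move=> hX hY vR; have hXT := GammaD_tangent hX; have hYT := GammaD_tangent hY.
rewrite nabhat_dot_screen //; last exact: (phiRad_screen C).
rewrite -(mean_dot_Rad hXT (GammaD_tangent (GammaD_phi hY)) vR).
rewrite mean_phi_dot // ?metric_phiN ?opprK //.
- by rewrite (D_nu_perp_phi_Rad (hX.2 p) vR) oppr0.
- by rewrite metricC metric_nu (eta_Rad C).
Qed.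

(** As for Rad; here the product with L1 only sees the screen transversal
    part. *)
Lemma nabhat_dot_phi_L1 X Y p l : GammaD X -> GammaD Y -> l \in L1 C p ->
  metric S (imm L p) (nabhat X Y p) (phi S (imm L p) l) =
  - (2^-1 * (metric S (imm L p) (hss X (phi_along L Y) p) l +
             metric S (imm L p) (hs X (phi_along L Y) p) l)).
Proof.
move=> hX hY lL; have hXT := GammaD_tangent hX; have hYT := GammaD_tangent hY.
have lS := L1_screen_transversal lL.
rewrite nabhat_dot_screen //; last exact: D'_screen (phi_L1 lL).
rewrite -(mean_dot_screen_transversal hXT (GammaD_tangent (GammaD_phi hY)) lS).
rewrite mean_phi_dot // ?metric_phiN ?opprK //.
- by rewrite (D_nu_perp_phi_L1 (hX.2 p) lL) oppr0.
- by rewrite metricC metric_nu (eta_L1 lL).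
Qed.

(** The same quantity without phi on Y: as eta vanishes on L1, phi can be applied
    to both factors, and then moved inside the covariant derivative. *)
Lemma second_form_dot_L1 X Y p l : GammaD X -> GammaD Y -> l \in L1 C p ->
  2^-1 * (metric S (imm L p) (hss X Y p) l + metric S (imm L p) (hs X Y p) l) =
  metric S (imm L p) (nabhat X (phi_along L Y) p) (phi S (imm L p) l).
Proof.
move=> hX hY lL; have hXT := GammaD_tangent hX; have hYT := GammaD_tangent hY.
have hpYT := GammaD_tangent (GammaD_phi hY).
have lS := L1_screen_transversal lL.
rewrite nabhat_dot_screen //; last exact: D'_screen (phi_L1 lL).
rewrite -(mean_dot_screen_transversal hXT hYT lS) mean_phi_dot //.
- by rewrite metric_phi (eta_L1 lL) mulr0 subr0.
- by rewrite metric_phi (eta_L1 lL) mulr0 subr0 metricC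
    (screen_transversal_perp lS (hXT.2 p)).
- by rewrite metricC metric_nu (eta_D' (phi_L1 lL)).
Qed.

End SecondFundamentalForms.

Theorem theorem4p3 (R : realType) (n q m : nat) (Mbar : manifold R n.*2.+1)
  (S : kenmotsu_statistical Mbar q) (M : manifold R m)
  (L : lightlike_submanifold M (metric S)) (C : contact_CR_lightlike L)
  (D Ds : along_op n.*2.+1 M)
  (HD : induced_connection (imm L) (conn S) D)
  (HDs : induced_connection (imm L) (dconn S) Ds)
  (nab hl hs nabs hls hss nabhat : along_op n.*2.+1 M)
  (Hgauss : gauss_formula L D nab hl hs)
  (Hgausss : gauss_formula L Ds nabs hls hss)
  (Hnabhat : tangential_component L (mean_along D Ds) nabhat) :
  totally_geodesic_foliation L nabhat (D_nu C) <->
  (forall X Y xi : M -> 'rV[R]_(n.*2.+1),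
     is_section (imm L) (D_nu C) X -> is_section (imm L) (D_nu C) Y ->
     is_section (imm L) (Rad L) xi ->
     forall p,
       metric S (imm L p) (hls X (phi_along L Y) p) (xi p)
       + metric S (imm L p) (hl X (phi_along L Y) p) (xi p) = 0) /\
  (forall X Y W : M -> 'rV[R]_(n.*2.+1),
     is_section (imm L) (D_nu C) X -> is_section (imm L) (D_nu C) Y ->
     is_section (imm L) (phi_img L (L1 C)) W ->
     forall p,
       metric S (imm L p) (hss X Y p) (phi_along L W p)
       + metric S (imm L p) (hs X Y p) (phi_along L W p) = 0).
Proof.
have half0 (x : R) : 2^-1 * x = 0 -> x = 0.
  by move=> /eqP; rewrite mulf_eq0 invr_eq0 pnatr_eq0 => /eqP.
split=> [geod|[condRad condL1] X Y hX hY].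
  split=> [X Y xi hX hY hxi p|X Y W hX hY hW p].
    apply: half0; apply/eqP; rewrite -oppr_eq0; apply/eqP.
    rewrite -(nabhat_dot_phi_Rad HD HDs Hgauss Hgausss Hnabhat hX hY (hxi.2 p)).
    exact: D_nu_perp_phi_Rad ((geod X Y hX hY).2 p) (hxi.2 p).
  have /memv_imgP[l lL Wp] := hW.2 p.
  (* W p = phi l, so phi W = -l at p. *)
  rewrite /phi_along Wp (phi_phi_L1 lL) !linearNr /= -opprD; apply/eqP.
  rewrite oppr_eq0; apply/eqP; apply: half0.
  rewrite (second_form_dot_L1 HD HDs Hgauss Hgausss Hnabhat hX hY lL).
  exact: D_nu_perp_phi_L1 ((geod X _ hX (GammaD_phi hY)).2 p) lL.
have [[nabS nabT] _] :=
  Hnabhat _ _ (GammaD_tangent hX) (GammaD_tangent hY).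
split=> // p; apply: mem_D_nu_of_orthogonal => // [v vR|l lL].
  have [xi hxi <-] := exists_section (imm_smooth L) (Rad_subbundle L) vR.
  rewrite (nabhat_dot_phi_Rad HD HDs Hgauss Hgausss Hnabhat hX hY (hxi.2 p)).
  by rewrite condRad // mulr0 oppr0.
have [V hV Vp] := exists_section (imm_smooth L) (L1_subbundle C) lL.
(* The condition on W = phi V is used for the pair (X, phi Y). *)
have hW : is_section (imm L) (phi_img L (L1 C)) (phi_along L V).
  split; first exact: smooth_phi_along hV.1.
  by move=> r; apply: memv_img; exact: hV.2.
have := condL1 X _ _ hX (GammaD_phi hY) hW p.
rewrite /phi_along Vp (phi_phi_L1 lL) !linearNr /= -opprD => /eqP.
rewrite oppr_eq0 => /eqP h.
by rewrite (nabhat_dot_phi_L1 HD HDs Hgauss Hgausss Hnabhat hX hY lL) h mulr0 oppr0.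
Qed.
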